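(* Via the homomorphism $\Psi:U_q(\mathfrak{sp}_{2n})\to U_q^{2n}\subseteq\operatorname{End}_{\mathbf{k}}(\mathcal X)$ (so $E_i,F_i,K_i^{\pm1}$ act by $e_i,f_i,k_i^{\pm1}$), the algebra $\mathcal X$ is a left $U_q(\mathfrak{sp}_{2n})$-module algebra, i.e. $h.1=\varepsilon(h)1$ and $h.(uv)=\sum(h_{(1)}.u)(h_{(2)}.v)$ for all $h\in U_q(\mathfrak{sp}_{2n})$, $u,v\in\mathcal X$, where $\Delta(h)=\sum h_{(1)}\otimes h_{(2)}$.
   Context: Let $\mathbf{k}$ be a field of characteristic $0$, $q\in\mathbf{k}$ invertible and not a root of unity, $n\ge 2$, $I=\{-n,\dots,-1,1,\dots,n\}$, $I^+=\{1,\dots,n\}$, $\lambda=q-q^{-1}$, $[m]_q=\frac{q^m-q^{-m}}{q-q^{-1}}$. The quantum symplectic space $\mathcal X$ is the $\mathbf{k}$-algebra generated by $x_i$ ($i\in I$) with relations $x_jx_i=qx_ix_j$ for $i<j$, $j\neq-i$, and $x_ix_{-i}=q^2x_{-i}x_i+q^2\lambda\Omega_{i+1}$ ($i\in I^+$), where $\Omega_i=\sum_{j=i}^nq^{j-i}x_{-j}x_j$, $\Omega_{n+1}=0$. Normal monomials $x^a=x_{-n}^{a_{-n}}\cdots x_{-1}^{a_{-1}}x_1^{a_1}\cdots x_n^{a_n}$ form a basis. Operators: $\partial_i.x^a=[a_i]_qx^{a-\varepsilon_i}$, $x_{i_L}.f=x_if$, $x_{i_R}.f=fx_i$, $\mu_i^{\pm1}.x^a=q^{\pm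 a_i}x^a$; $\tau_i=\prod_{j=i}^n\mu_j$, $\tau_{-i}=\prod_{j=-n}^{-i}\mu_j$ ($i\in I^+$), $\tau_{\pm(n+1)}=1$. $e_1=[2]_q^{-1}q^{-1}\mu_1^{-1}(\tau_{-2}^{-1}x_{-1_L}+q^2\tau_2^{-1}x_{-1_R})\partial_1$, $f_1=[2]_q^{-1}q^{-1}\mu_{-1}^{-1}(\tau_2^{-1}x_{1_R}+q^2\tau_{-2}^{-1}x_{1_L})\partial_{-1}$, $k_1=\mu_{-1}^2\mu_1^{-2}$, and for $2\le i\le n$: $e_i=\mu_{i-1}\mu_i^{-1}\tau_{-i-1}^{-1}x_{-i_L}\partial_{1-i}-\tau_i^{-1}x_{i-1_R}\partial_i$, $f_i=-\mu_{1-i}\mu_{-i}^{-1}\tau_{i+1}^{-1}x_{i_R}\partial_{i-1}+\tau_{-i}^{-1}x_{1-i_L}\partial_{-i}$, $k_i=\mu_{-i}\mu_{1-i}^{-1}\mu_{i-1}\mu_i^{-1}$. $U_q^{2n}$ is the subalgebra of $\operatorname{End}(\mathcal X)$ generated by these; $\Psi$ is the surjective algebra homomorphism $U_q(\mathfrak{sp}_{2n})\to U_q^{2n}$, $E_i\mapsto e_i$, $F_i\mapsto f_i$, $K_i^{\pm1}\mapsto k_i^{\pm1}$ (its existence is part of the paper's results). $U_q(\mathfrak{sp}_{2n})$ is the standard Drinfeld–Jimbo quantum group of type $C_n$ (simple roots $\alpha_1=2\epsilon_1$ long, $\alpha_i=\epsilon_i-\epsilon_{i-1}$, $q_1=q^2$,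 $q_i=q$ for $i>1$), with Hopf structure $\Delta(E_i)=E_i\otimes K_i+1\otimes E_i$, $\Delta(F_i)=F_i\otimes1+K_i^{-1}\otimes F_i$, $\Delta(K_i^{\pm1})=K_i^{\pm1}\otimes K_i^{\pm1}$, $\varepsilon(E_i)=\varepsilon(F_i)=0$, $\varepsilon(K_i^{\pm1})=1$. *)

(* Defs.v *)
From HB Require Import structures.
From mathcomp Require Import all_boot all_order all_algebra.
Set Implicit Arguments. Unset Strict Implicit. Unset Printing Implicit Defensive.
Import Order.TTheory GRing.Theory Num.Theory.
Local Open Scope ring_scope.

Definition inI (n : nat) (i : int) : bool := (i != 0) && (absz i <= n)%N.

Definition Iseq (n : nat) : seq int :=
  [seq - (Posz (n - j)) | j <- iota 0 n] ++ [seq Posz j.+1 | j <- iota 0 n].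

(* exponent vectors a : I -> N (values outside I are irrelevant) *)
Definition expo := int -> nat.
Definition expo_dec (a : expo) (i : int) : expo :=
  fun j => if j == i then (a j).-1 else a j.

Definition qint (k : fieldType) (q : k) (m : nat) : k :=
  (q ^+ m - q ^- m) / (q - q^-1).

Definition comp_seq (T : Type) (fs : seq (T -> T)) : T -> T :=
  foldr (fun f g => f \o g) id fs.

(* Syntactic terms of the free k-algebra on E_i, F_i, K_i, K_i^{-1}
   (i = j+1 for j : 'I_n); U_q(sp_2n) is a quotient of it. *)
Inductive Uterm (k : Type) (n : nat) : Type :=
| UE of 'I_n | UF of 'I_n | UK of 'I_n | UKinv of 'I_n
| U1
| Uadd of Uterm k n & Uterm k n
| Umul of Uterm k n & Uterm k n
| Uscale of k & Uterm k n.

Section Hopf.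
Variables (k : fieldType) (n : nat).

(* coproduct, as a Sweedler sum (list of pairs h_(1), h_(2)) *)
Fixpoint coprod (h : Uterm k n) : seq (Uterm k n * Uterm k n) :=
  match h with
  | UE j => [:: (UE k j, UK k j); (U1 k n, UE k j)]
  | UF j => [:: (UF k j, U1 k n); (UKinv k j, UF k j)]
  | UK j => [:: (UK k j, UK k j)]
  | UKinv j => [:: (UKinv k j, UKinv k j)]
  | U1 => [:: (U1 k n, U1 k n)]
  | Uadd a b => coprod a ++ coprod b
  | Umul a b => [seq (Umul p.1 r.1, Umul p.2 r.2) | p <- coprod a, r <- coprod b]
  | Uscale c a => [seq (Uscale c p.1, p.2) | p <- coprod a]
  end.

Fixpoint counit (h : Uterm k n) : k :=
  match h with
  | UE _ | UF _ => 0
  | UK _ | UKinv _ | U1 => 1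
  | Uadd a b => counit a + counit b
  | Umul a b => counit a * counit b
  | Uscale c a => c * counit a
  end.
End Hopf.

Section QSymp.
Variables (k : fieldType) (A : algType k) (n : nat) (q : k) (x : int -> A).

Definition mono (a : expo) : A := \prod_(i <- Iseq n) x i ^+ a i.

Definition Omega (p : nat) : A :=
  \sum_(p <= j < n.+1) q ^+ (j - p) *: (x (- Posz j) * x (Posz j)).

Definition qsymp_rel : Prop :=
  (forall i j : int, inI n i -> inI n j -> i < j -> j != - i ->
      x j * x i = q *: (x i * x j)) /\
  (forall i : nat, (1 <= i <= n)%N ->
      x (Posz i) * x (- Posz i) =
        q ^+ 2 *: (x (- Posz i) * x (Posz i))
        + (q ^+ 2 * (q - q^-1)) *: Omega i.+1).

Definition expo_default : expo * k := (fun _ => 0%N, 0).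

Definition normal_basis : Prop :=
  (forall u : A, exists s : seq (expo * k),
      u = \sum_(p <- s) p.2 *: mono p.1) /\
  (forall s : seq (expo * k),
      (forall j1 j2, (j1 < size s)%N -> (j2 < size s)%N -> j1 <> j2 ->
         exists i, inI n i /\
           (nth expo_default s j1).1 i <> (nth expo_default s j2).1 i) ->
      \sum_(p <- s) p.2 *: mono p.1 = 0 ->
      forall j, (j < size s)%N -> (nth expo_default s j).2 = 0).

Variables (d mu muinv : int -> A -> A).

Definition ops_spec : Prop :=
  (forall i, linear (d i)) /\ (forall i, linear (mu i)) /\
  (forall i, linear (muinv i)) /\
  (forall i a, inI n i -> d i (mono a) = qint q (a i) *: mono (expo_dec a i)) /\
  (forall i a, inI n i -> mu i (mono a) = q ^+ a i *: mono a) /\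
  (forall i a, inI n i -> muinv i (mono a) = q ^- a i *: mono a).

Definition tauinvP (p : nat) : A -> A :=
  comp_seq [seq muinv (Posz j) | j <- iota p (n.+1 - p)].
Definition tauinvN (p : nat) : A -> A :=
  comp_seq [seq muinv (- Posz j) | j <- iota p (n.+1 - p)].

Definition e_op (i : nat) : A -> A :=
  if i == 1%N then
    fun u => ((qint q 2)^-1 * q^-1) *:
      muinv 1 (tauinvN 2 (x (-1) * d 1 u) + q ^+ 2 *: tauinvP 2 (d 1 u * x (-1)))
  else
    fun u => mu (Posz i - 1) (muinv (Posz i) (tauinvN i.+1 (x (- Posz i) * d (1 - Posz i) u)))
             - tauinvP i (d (Posz i) u * x (Posz i - 1)).

Definition f_op (i : nat) : A -> A :=
  if i == 1%N then
    fun u => ((qint q 2)^-1 * q^-1) *: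
      muinv (-1) (tauinvP 2 (d (-1) u * x 1) + q ^+ 2 *: tauinvN 2 (x 1 * d (-1) u))
  else
    fun u => - mu (1 - Posz i) (muinv (- Posz i) (tauinvP i.+1 (d (Posz i - 1) u * x (Posz i))))
             + tauinvN i (x (1 - Posz i) * d (- Posz i) u).

Definition k_op (i : nat) : A -> A :=
  if i == 1%N then mu (-1) \o mu (-1) \o muinv 1 \o muinv 1
  else mu (- Posz i) \o muinv (1 - Posz i) \o mu (Posz i - 1) \o muinv (Posz i).

Definition kinv_op (i : nat) : A -> A :=
  if i == 1%N then muinv (-1) \o muinv (-1) \o mu 1 \o mu 1
  else muinv (- Posz i) \o mu (1 - Posz i) \o muinv (Posz i - 1) \o mu (Posz i).

(* the action h |-> Psi(h) (lifted to the free algebra) *)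
Fixpoint act (h : Uterm k n) : A -> A :=
  match h with
  | UE j => e_op j.+1
  | UF j => f_op j.+1
  | UK j => k_op j.+1
  | UKinv j => kinv_op j.+1
  | U1 => id
  | Uadd a b => fun u => act a u + act b u
  | Umul a b => act a \o act b
  | Uscale c a => fun u => c *: act a u
  end.
End QSymp.

(* Main.v *)
Require Import Defs.
From HB Require Import structures.
From mathcomp Require Import all_boot all_order all_algebra.
From mathcomp Require Import zify ring.
Set Implicit Arguments. Unset Strict Implicit. Unset Printing Implicit Defensive.
Import Order.TTheory GRing.Theory Num.Theory.
Local Open Scope ring_scope.

(** The identity [e (u v) = e u * k v + u * e v], together with [k (u v) = k u * k v],
    says that [u |-> [[u, e u], [0, k u]]] is multiplicative.  Any linear map sending the
    normal monomials in the [x i] to the normal monomials in elements [y i] of another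
    algebra that satisfy the same relations is multiplicative: rewriting with the
    relations takes any word to normal monomials, with the same coefficients on both
    sides.  So it is enough to check the relations for the triangular matrices attached to
    the generators and to compute [e] and [k] on normal monomials.  The operators [f] follow by symmetry:
    [x i |-> x (- i)] satisfies the relations of the quantum symplectic space in the
    converse algebra, and exchanges [e] with [f] up to sign and [k] with its inverse. *)

(** * Linear maps given as bare functions satisfying [linear] *)

Section LinearPredicate.
Variables (k : fieldType) (U V : lmodType k) (f : U -> V).
Hypothesis f_lin : linear f.

Lemma linearf0 : f 0 = 0.
Proof.
pose fL : {linear U -> V} := HB.pack f (GRing.isLinear.Build k U V *:%R f f_lin).
exact: (linear0 fL).
Qed.

Lemma linearfZ c u : f (c *: u) = c *: f u.
Proof. by rewrite -[c *: u]addr0 f_lin linearf0 addr0. Qed.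

Lemma linearfD u v : f (u + v) = f u + f v.
Proof. by rewrite -[u in LHS]scale1r f_lin scale1r. Qed.

Lemma linearf_sum I (r : seq I) (F : I -> U) :
  f (\sum_(i <- r) F i) = \sum_(i <- r) f (F i).
Proof. exact: (big_morph f linearfD linearf0). Qed.

End LinearPredicate.

(* The library's [A^c] carries no module structure. *)
Definition convalg (k : fieldType) (A : algType k) : Type := A^c.

(** * The opposite algebra as a [k]-algebra *)

Section Converse.
Variables (k : fieldType) (A : algType k).
Local Notation C := (convalg A).

HB.instance Definition _ := GRing.NzRing.copy C A^c.
HB.instance Definition _ := GRing.Zmodule_isLmodule.Build k C
  (@scalerA k A) (@scale1r k A) (@scalerDr k A) (fun v a b => @scalerDl k A v a b).

Fact convalg_scalerAl (c : k) (u v : C) : c *: (u * v) = (c *: u) * v.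
Proof. by have := @scalerAr k A c v u. Qed.

HB.instance Definition _ := GRing.Lmodule_isLalgebra.Build k C convalg_scalerAl.

Fact convalg_scalerAr (c : k) (u v : C) : c *: (u * v) = u * (c *: v).
Proof. by have := @scalerAl k A c v u. Qed.

HB.instance Definition _ := GRing.Lalgebra_isAlgebra.Build k C convalg_scalerAr.

End Converse.

(* [(u, w, v)] stands for the upper triangular matrix [[u, w], [0, v]]. *)
Definition utri (A : Type) : Type := (A * A * A)%type.

(** * The ring, then the algebra, of upper triangular two-by-two matrices *)

Section UTri.
Variable A : nzRingType.

HB.instance Definition _ := GRing.Zmodule.copy (utri A) (A * A * A)%type.

Definition utri_one : utri A := (1, 0, 1).
Definition utri_mul (X Y : utri A) : utri A :=
  (X.1.1 * Y.1.1, X.1.1 * Y.1.2 + X.1.2 * Y.2, X.2 * Y.2).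

Fact utri_mulA : associative utri_mul.
Proof.
move=> [[a b] c] [[a' b'] c'] [[a'' b''] c'']; rewrite /utri_mul /=.
by rewrite !mulrDr !mulrDl !mulrA !addrA.
Qed.
Fact utri_mul1 : left_id utri_one utri_mul.
Proof. by move=> [[a b] c]; rewrite /utri_mul /= !mul1r mul0r addr0. Qed.
Fact utri_mulr1 : right_id utri_one utri_mul.
Proof. by move=> [[a b] c]; rewrite /utri_mul /= !mulr1 mulr0 add0r. Qed.
Fact utri_mulDl : left_distributive utri_mul +%R.
Proof.
move=> [[a b] c] [[a' b'] c'] [[a'' b''] c'']; rewrite /utri_mul /=.
by congr (_, _, _); rewrite !mulrDl // addrACA.
Qed.
Fact utri_mulDr : right_distributive utri_mul +%R.
Proof.
move=> [[a b] c] [[a' b'] c'] [[a'' b''] c'']; rewrite /utri_mul /=.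
by congr (_, _, _); rewrite !mulrDr // addrACA.
Qed.
Fact utri_one_neq0 : utri_one != 0.
Proof. by rewrite !xpair_eqE /= oner_eq0. Qed.

HB.instance Definition _ := GRing.Zmodule_isNzRing.Build (utri A)
  utri_mulA utri_mul1 utri_mulr1 utri_mulDl utri_mulDr utri_one_neq0.

Lemma utriM (X Y : utri A) :
  X * Y = (X.1.1 * Y.1.1, X.1.1 * Y.1.2 + X.1.2 * Y.2, X.2 * Y.2).
Proof. by []. Qed.

Lemma utriD (X Y : utri A) : X + Y = (X.1.1 + Y.1.1, X.1.2 + Y.1.2, X.2 + Y.2).
Proof. by []. Qed.

End UTri.

Section UTriAlg.
Variables (k : fieldType) (A : algType k).

HB.instance Definition _ := GRing.Zmodule_isLmodule.Build k (utri A)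
  (@scalerA k (A * A * A)%type) (@scale1r k (A * A * A)%type)
  (@scalerDr k (A * A * A)%type) (fun v a b => @scalerDl k (A * A * A)%type v a b).

Lemma utriZ c (X : utri A) : c *: X = (c *: X.1.1, c *: X.1.2, c *: X.2).
Proof. by []. Qed.

Fact utri_scalerAl (c : k) (X Y : utri A) : c *: (X * Y) = (c *: X) * Y.
Proof.
by rewrite !(utriM, utriZ) /= scalerDr -!scalerAl.
Qed.

HB.instance Definition _ :=
  GRing.Lmodule_isLalgebra.Build k (utri A) utri_scalerAl.

Fact utri_scalerAr (c : k) (X Y : utri A) : c *: (X * Y) = X * (c *: Y).
Proof.
by rewrite !(utriM, utriZ) /= scalerDr -!scalerAr.
Qed.

HB.instance Definition _ :=
  GRing.Lalgebra_isAlgebra.Build k (utri A) utri_scalerAr.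

End UTriAlg.

(** * Words in the generators; sorted words as normal monomials *)

Section Words.
Variable n : nat.

Definition prodw (R : nzRingType) (x : int -> R) (w : seq int) : R :=
  \prod_(i <- w) x i.

Lemma prodw_cat (R : nzRingType) (x : int -> R) w1 w2 :
  prodw x (w1 ++ w2) = prodw x w1 * prodw x w2.
Proof. exact: big_cat. Qed.

Lemma prodw2 (R : nzRingType) (x : int -> R) i j : prodw x [:: i; j] = x i * x j.
Proof. by rewrite /prodw !big_cons big_nil mulr1. Qed.

(** Spells a monomial letter by letter, so that a relation can be applied to two adjacent
    letters. *)
Definition exword (s : seq int) (a : expo) : seq int :=
  flatten [seq nseq (a i) i | i <- s].

Lemma mem_Iseq i : (i \in Iseq n) = inI n i.
Proof.
rewrite /Iseq mem_cat /inI; apply/orP/idP => [[]|].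
- by case/mapP => j; rewrite mem_iota => Hj ->; lia.
- by case/mapP => j; rewrite mem_iota => Hj ->; lia.
move=> Hi; case: (ltP i 0) => Hi0.
  left; apply/mapP; exists (n - `|i|)%N; first by rewrite mem_iota; lia.
  lia.
by right; apply/mapP; exists `|i|.-1; rewrite ?mem_iota; lia.
Qed.

(** Monotonicity is asked for on the interval only, because the truncated difference in [Iseq] is
    constant beyond [n]. *)
Lemma sorted_map_iota (f : nat -> int) m l :
  {in [pred j | (m <= j < m + l)%N] &, {homo f : i j / (i < j)%N >-> i < j}} ->
  sorted <%R [seq f j | j <- iota m l].
Proof.
move=> Hf; rewrite sorted_map.
have := iota_ltn_sorted m l.
apply: (@sub_in_sorted _ [pred j | (m <= j < m + l)%N]) => [i j Hi Hj Hij|].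
  exact: Hf.
by apply/allP => i; rewrite mem_iota.
Qed.

Lemma Iseq_sorted : sorted <%R (Iseq n).
Proof.
rewrite (sorted_pairwise lt_trans) /Iseq pairwise_cat -!(sorted_pairwise lt_trans).
apply/and3P; split.
- apply/allrelP => i j /mapP[a _ ->] /mapP[b _ ->]; lia.
- by apply: sorted_map_iota => i j /= Hi Hj; rewrite !inE in Hi Hj *; lia.
- by apply: sorted_map_iota => i j /= Hi Hj; lia.
Qed.

Lemma prodw_exword (R : nzRingType) (x : int -> R) s a :
  prodw x (exword s a) = \prod_(i <- s) x i ^+ a i.
Proof.
elim: s => [|i s IHs]; first by rewrite /prodw /exword /= !big_nil.
rewrite /exword /= prodw_cat -/(exword s a) IHs big_cons /prodw; congr (_ * _).
elim: (a i) => [|m IHm] /=; first by rewrite big_nil.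
by rewrite big_cons IHm exprS.
Qed.

Lemma mem_exword s a i : i \in exword s a -> i \in s.
Proof. by case/flattenP => w /mapP[j Hj ->]; rewrite mem_nseq => /andP[_ /eqP ->]. Qed.

Lemma count_exword s a i :
  uniq s -> count_mem i (exword s a) = if i \in s then a i else 0%N.
Proof.
elim: s => [|j s IHs] //= /andP[Hj Hs].
rewrite /exword /= count_cat -/(exword s a) IHs // count_nseq in_cons /=.
case: (eqVneq i j) => [-> | Hij] /=; first by rewrite (negPf Hj) addn0 mul1n.
by rewrite mul0n.
Qed.

Lemma exword_sorted s a : sorted <=%R s -> sorted <=%R (exword s a).
Proof.
rewrite !(sorted_pairwise le_trans).
elim: s => [|i s IHs] //= /andP[Hi Hs].
rewrite /exword /= pairwise_cat -/(exword s a) IHs // andbT; apply/andP; split.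
  apply/allrelP => j l; rewrite mem_nseq => /andP[_ /eqP ->] /mem_exword Hl.
  exact: (allP Hi).
elim: (a i) => [|m IHm] //=; rewrite IHm andbT.
by apply/allP => j; rewrite mem_nseq => /andP[_ /eqP ->].
Qed.

Lemma Iseq_uniq : uniq (Iseq n).
Proof. exact: (sorted_uniq lt_trans ltxx Iseq_sorted). Qed.

(** A sorted list is determined by the multiplicities of its letters, so the words that admit no
    further rewriting are exactly the normal monomials. *)
Lemma sorted_exword w :
  all (inI n) w -> sorted <=%R w -> w = exword (Iseq n) (fun i => count_mem i w).
Proof.
move=> Hw Hs; apply: (@sorted_eq _ <=%R) => //; try exact: le_trans.
- exact: le_anti.
- apply: exword_sorted; move: Iseq_sorted; apply: sub_sorted => i j; exact: ltW.
apply/allP => i _ /=; rewrite count_exword ?Iseq_uniq // mem_Iseq.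
case: ifP => // Hi; apply/eqP/count_memPn; apply/negP => /(allP Hw).
by rewrite Hi.
Qed.

Lemma unsorted_descent (w : seq int) :
  ~~ sorted <=%R w -> exists u i j v, w = u ++ [:: j; i] ++ v /\ i < j.
Proof.
elim: w => [|a [|b w] IHw] //=.
rewrite negb_and; case: (leP a b) => /= Hab; last by exists [::], b, a, w.
by move/IHw => [u [i [j [v [-> Hij]]]]]; exists (a :: u), i, j, v.
Qed.

End Words.

(** * Multiplicativity of linear maps prescribed on normal monomials *)

Section OrderedMonomials.
Variables (k : fieldType) (n : nat) (q : k).

(** Reads a word in base 2n + 1 with digits i + n, so that words of equal length are compared
    lexicographically by natural numbers. *)
Definition wcode (w : seq int) : nat :=
  foldl (fun c i => (c * n.*2.+1 + absz (i + Posz n)%R)%N) 0%N w.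

Lemma wcode_cat u w :
  wcode (u ++ w) = (wcode u * n.*2.+1 ^ size w + wcode w)%N.
Proof.
elim/last_ind: w => [|w i IHw]; first by rewrite cats0 muln1 addn0.
by rewrite -rcons_cat /wcode !foldl_rcons -!/(wcode _) IHw size_rcons expnS; ring.
Qed.

(** Only the first letter of the replaced pair has to drop: the second digit stays below the base
    and cannot make up for it. *)
Lemma wcode_descent u v i j i' j' :
  inI n i -> inI n j -> inI n i' -> inI n j' -> i' < j ->
  (wcode (u ++ [:: i'; j'] ++ v) < wcode (u ++ [:: j; i] ++ v))%N.
Proof.
move=> Hi Hj Hi' Hj' Hlt; rewrite !wcode_cat ltn_add2l ltn_add2r ltn_pmul2r ?expn_gt0 //.
rewrite /wcode /= !mul0n !add0n /inI in Hi Hj Hi' Hj' *; nia.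
Qed.

Variables (A B : algType k) (x : int -> A) (y : int -> B) (phi : A -> B).
Hypotheses (relx : qsymp_rel n q x) (rely : qsymp_rel n q y).
Hypothesis phi_lin : linear phi.
Hypothesis phi_mono : forall a, phi (mono n x a) = mono n y a.

(** Brings both kinds of relation into one shape. The list is chosen before the algebra, so the same
    coefficients serve in [A] and in [B]. *)
Lemma descent_rel i j : inI n i -> inI n j -> i < j ->
  exists s : seq (k * (int * int)),
    (forall t, t \in s -> [/\ inI n t.2.1, inI n t.2.2 & t.2.1 < j]) /\
    (forall (C : algType k) (z : int -> C), qsymp_rel n q z ->
       z j * z i = \sum_(t <- s) t.1 *: (z t.2.1 * z t.2.2)).
Proof.
move=> Hi Hj Hij; case: (eqVneq j (- i)) => [Eji | Nji]; last first.
  exists [:: (q, (i, j))]; split=> [t | C z [relz _]].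
    by rewrite inE => /eqP ->.
  by rewrite big_seq1 relz.
have [m Em] : exists m, j = Posz m by exists `|j|%N; lia.
have Ei : i = - Posz m by lia.
have Hm : (1 <= m <= n)%N by move: Hj; rewrite Em /inI; lia.
(* The sum Omega_{m+1} is expanded: each of its terms begins with some x_{-l}, hence with a letter
   below [j]. *)
exists ((q ^+ 2, (i, j)) :: [seq (q ^+ 2 * (q - q^-1) * q ^+ (l - m.+1),
                                  (- Posz l, Posz l)) | l <- index_iota m.+1 n.+1]).
split=> [t | C z [_ relz]].
  rewrite inE => /orP[/eqP -> // | /mapP[l]].
  by rewrite mem_index_iota => Hl -> /=; rewrite /inI; split; lia.
rewrite big_cons big_map Em Ei relz // /Omega scaler_sumr; congr (_ + _).
by apply: eq_bigr => l _; rewrite scalerA.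
Qed.

(* Well-founded rewriting: each defining relation, read from left to right,
   replaces a descent by lexicographically smaller words of the same length. *)
Lemma phi_prodw w : all (inI n) w -> phi (prodw x w) = prodw y w.
Proof.
have [N HN] := ubnP (wcode w); elim: N => // N IH in w HN *.
move=> Iw; have [Sw | /unsorted_descent[u [i [j [v [Ew Hij]]]]]] := boolP (sorted <=%R w).
  by rewrite (sorted_exword Iw Sw) !prodw_exword; exact: phi_mono.
move: Iw; rewrite Ew !all_cat /= => /and3P[Iu /and3P[Hj Hi _] Iv].
have [s [Hs Es]] := descent_rel Hi Hj Hij.
have Ez (C : algType k) (z : int -> C) : qsymp_rel n q z ->
    prodw z (u ++ [:: j; i] ++ v) =
    \sum_(t <- s) t.1 *: prodw z (u ++ [:: t.2.1; t.2.2] ++ v).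
  move=> relz; rewrite !prodw_cat prodw2 Es //.
  rewrite mulr_suml mulr_sumr; apply: eq_bigr => t _.
  by rewrite !prodw_cat prodw2 -scalerAl -scalerAr.
rewrite !Ez // (linearf_sum phi_lin) big_seq [RHS]big_seq; apply: eq_bigr => t /Hs[H1 H2 H3].
rewrite (linearfZ phi_lin) IH //; last by rewrite !all_cat /= H1 H2 Iu Iv.
rewrite ltnS Ew in HN; apply: leq_trans HN; exact: wcode_descent.
Qed.

Hypothesis spanx : forall u : A, exists s : seq (expo * k),
  u = \sum_(p <- s) p.2 *: mono n x p.1.

Lemma mono1 (C : algType k) (z : int -> C) : mono n z (fun _ => 0%N) = 1.
Proof. by rewrite /mono big1. Qed.

Lemma phi1 : phi 1 = 1.
Proof. by rewrite -(mono1 x) phi_mono mono1. Qed.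

(** The product of two normal monomials is a single concatenated word, covered by [phi_prodw]; the
    general case follows by bilinearity, since normal monomials span. *)
Lemma phiM u v : phi (u * v) = phi u * phi v.
Proof.
have Iw a : all (inI n) (exword (Iseq n) a).
  by apply/allP => i /mem_exword; rewrite mem_Iseq.
have phiMM a b : phi (mono n x a * mono n x b) = phi (mono n x a) * phi (mono n x b).
  rewrite !phi_mono /mono -!prodw_exword -!prodw_cat phi_prodw //.
  by rewrite all_cat !Iw.
have phiMr a t : phi (mono n x a * t) = phi (mono n x a) * phi t.
  have [s ->] := spanx t; rewrite mulr_sumr !(linearf_sum phi_lin) mulr_sumr.
  by apply: eq_bigr => b _; rewrite -scalerAr !(linearfZ phi_lin) phiMM -scalerAr.
have [s ->] := spanx u; rewrite mulr_suml !(linearf_sum phi_lin) mulr_suml.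
by apply: eq_bigr => b _; rewrite -scalerAl !(linearfZ phi_lin) phiMr -scalerAl.
Qed.

End OrderedMonomials.

(** * Inserting a generator in a normal monomial *)

Section Ranges.

Definition range (b : int) (m : nat) : seq int := [seq b + Posz j | j <- iota 0 m].

Lemma mem_range b m i : (i \in range b m) = (b <= i < b + Posz m).
Proof.
apply/mapP/idP => [[j] | Hi]; first by rewrite mem_iota => Hj ->; lia.
by exists `|i - b|%N; rewrite ?mem_iota; lia.
Qed.

Lemma range_uniq b m : uniq (range b m).
Proof. by rewrite map_inj_uniq ?iota_uniq // => i j; lia. Qed.

Lemma rangeD b m1 m2 : range b (m1 + m2) = range b m1 ++ range (b + Posz m1) m2.
Proof.
rewrite /range iotaD map_cat; congr (_ ++ _).
rewrite add0n -{1}[m1]addn0 iotaDl -map_comp; apply: eq_map => j /=; lia.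
Qed.

Lemma range1 b : range b 1 = [:: b].
Proof. by rewrite /range /= addr0. Qed.

Lemma rangeS b m : range b m.+1 = b :: range (b + 1) m.
Proof. by rewrite -add1n rangeD range1. Qed.

Lemma range_split b m b' m1 m2 :
  b' = b + Posz m1 -> m = (m1 + m2)%N -> range b m = range b m1 ++ range b' m2.
Proof. by move=> -> ->; exact: rangeD. Qed.

Lemma range_cons b m b' m' : b' = b + 1 -> m = m'.+1 -> range b m = b :: range b' m'.
Proof. by move=> -> ->; exact: rangeS. Qed.

Lemma IseqE n : Iseq n = range (- Posz n) n ++ range 1 n.
Proof.
rewrite /Iseq /range; congr (_ ++ _).
by apply/eq_in_map => j; rewrite mem_iota => Hj; lia.
Qed.

Lemma Iseq_splitN n p : (1 <= p <= n)%N ->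
  Iseq n = range (- Posz n) (n - p) ++ - Posz p :: range (1 - Posz p) p.-1 ++ range 1 n.
Proof.
move=> Hp; rewrite IseqE (@range_split _ _ (- Posz p) (n - p) p); try lia.
by rewrite (@range_cons (- Posz p) p (1 - Posz p) p.-1) -?catA //; lia.
Qed.

Lemma Iseq_splitP n p : (1 <= p <= n)%N ->
  Iseq n = (range (- Posz n) n ++ range 1 p.-1) ++ Posz p :: range (Posz p.+1) (n - p).
Proof.
move=> Hp; rewrite IseqE (@range_split 1 _ (Posz p) p.-1 (n - p).+1); try lia.
by rewrite (@range_cons (Posz p) _ (Posz p.+1) (n - p)) -?catA //; lia.
Qed.

(** Isolates the four indices that e_{p+1} and k_{p+1} affect, in their order inside a normal
    monomial. *)
Lemma Iseq_split4 n p : (1 <= p < n)%N ->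
  Iseq n = range (- Posz n) (n - p.+1) ++ [:: - Posz p.+1; - Posz p] ++
           (range (1 - Posz p) p.-1 ++ range 1 p.-1) ++
           [:: Posz p; Posz p.+1] ++ range (Posz p.+2) (n - p.+1).
Proof.
move=> Hp; rewrite (@Iseq_splitN n p.+1); last by lia.
rewrite (@range_cons (1 - Posz p.+1) _ (1 - Posz p) p.-1); try lia.
rewrite (@range_split 1 n (Posz p) p.-1 (n - p.+1).+2); try lia.
rewrite (@range_cons (Posz p) _ (Posz p.+1) (n - p.+1).+1); try lia.
rewrite (@range_cons (Posz p.+1) _ (Posz p.+2) (n - p.+1)); try lia.
by rewrite !catA /= -!catA /=; congr (_ ++ _ :: _ :: _); lia.
Qed.

(** The degree of a block: the exponent of [q] picked up when a generator q-commutes across it. *)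
Definition wsum (s : seq int) (a : expo) : nat := (\sum_(i <- s) a i)%N.

Lemma wsum_rangeN n p a : (p <= n)%N ->
  wsum (range (- Posz n) (n - p)) a = (\sum_(j <- iota p.+1 (n - p)) a (- Posz j))%N.
Proof.
move=> Hp; rewrite /wsum -(big_map (fun j => - Posz j) xpredT a).
apply: perm_big; apply: uniq_perm; rewrite ?range_uniq //.
  by rewrite map_inj_uniq ?iota_uniq // => i j; lia.
move=> i; rewrite mem_range; apply/idP/mapP => [Hi | [j]].
  by exists `|i|%N; rewrite ?mem_iota; lia.
by rewrite mem_iota => Hj ->; lia.
Qed.

Lemma wsum_rangeP p m a : wsum (range (Posz p) m) a = (\sum_(j <- iota p m) a (Posz j))%N.
Proof.
rewrite /wsum /range -(big_map (fun j => Posz j) xpredT a) -[in RHS](addn0 p) iotaDl.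
by rewrite -map_comp.
Qed.

End Ranges.

Definition expo_inc (a : expo) (i : int) : expo :=
  fun j => if j == i then (a j).+1 else a j.

Lemma wsum_inc s a j : j \notin s -> wsum s (expo_inc a j) = wsum s a.
Proof.
by move=> Hj; apply: eq_big_seq => i Hi; rewrite /expo_inc; case: eqP Hj => // <-; rewrite Hi.
Qed.

(** * Moving a generator across blocks of a monomial *)

Section PartialMonomials.
Variables (k : fieldType) (A : algType k) (n : nat) (q : k) (x : int -> A).
Hypothesis relx : qsymp_rel n q x.

Definition pmono (s : seq int) (a : expo) : A := \prod_(i <- s) x i ^+ a i.

Lemma pmono_cat s t a : pmono (s ++ t) a = pmono s a * pmono t a.
Proof. exact: big_cat. Qed.

Lemma pmono_cons i s a : pmono (i :: s) a = x i ^+ a i * pmono s a.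
Proof. exact: big_cons. Qed.

Lemma pmono_nil a : pmono [::] a = 1.
Proof. exact: big_nil. Qed.

Lemma eq_pmono s a b : {in s, a =1 b} -> pmono s a = pmono s b.
Proof. by move=> E; apply: eq_big_seq => i /E ->. Qed.

Lemma pmono_inc s a j : j \notin s -> pmono s (expo_inc a j) = pmono s a.
Proof.
by move=> Hj; apply: eq_pmono => i Hi; rewrite /expo_inc; case: eqP Hj => // <-; rewrite Hi.
Qed.

Lemma pmono_dec s a j : j \notin s -> pmono s (expo_dec a j) = pmono s a.
Proof.
by move=> Hj; apply: eq_pmono => i Hi; rewrite /expo_dec; case: eqP Hj => // <-; rewrite Hi.
Qed.

Lemma qcommX (u v : A) c m : u * v = c *: (v * u) -> u * v ^+ m = c ^+ m *: (v ^+ m * u).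
Proof.
move=> E; elim: m => [|m IHm]; first by rewrite !expr0 mulr1 mul1r scale1r.
rewrite exprS mulrA E -scalerAl -[v * u * _]mulrA IHm -scalerAr scalerA mulrA.
by rewrite exprS.
Qed.

Lemma qcommXl (u v : A) c m : u * v = c *: (v * u) -> u ^+ m * v = c ^+ m *: (v * u ^+ m).
Proof.
move=> E; elim: m => [|m IHm]; first by rewrite !expr0 mulr1 mul1r scale1r.
rewrite exprSr -[_ * v]mulrA E -scalerAr [_ * (v * u)]mulrA IHm -scalerAl scalerA -mulrA.
by rewrite -exprSr -exprS.
Qed.

Lemma qcomm_pmono s a u :
  {in s, forall i, u * x i = q *: (x i * u)} ->
  u * pmono s a = q ^+ wsum s a *: (pmono s a * u).
Proof.
rewrite /pmono /wsum; elim: s => [|i s IHs] Hs.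
  by rewrite !big_nil mulr1 mul1r scale1r.
have Hi : u * x i = q *: (x i * u) by apply: Hs; rewrite mem_head.
rewrite !big_cons mulrA (qcommX _ Hi) -scalerAl -[_ * u * _]mulrA IHs; last first.
  by move=> j Hj; apply: Hs; rewrite in_cons Hj orbT.
by rewrite -scalerAr scalerA exprD mulrA.
Qed.

Lemma pmono_qcomm s a u :
  {in s, forall i, x i * u = q *: (u * x i)} ->
  pmono s a * u = q ^+ wsum s a *: (u * pmono s a).
Proof.
rewrite /pmono /wsum; elim: s => [|i s IHs] Hs.
  by rewrite !big_nil mulr1 mul1r scale1r.
have Hi : x i * u = q *: (u * x i) by apply: Hs; rewrite mem_head.
rewrite !big_cons -mulrA IHs; last by move=> j Hj; apply: Hs; rewrite in_cons Hj orbT.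
by rewrite -scalerAr [x i ^+ _ * (u * _)]mulrA (qcommXl _ Hi) -scalerAl scalerA -mulrA addnC exprD.
Qed.

Lemma lmul_pmono s1 j s2 a : uniq (s1 ++ j :: s2) ->
  {in s1, forall i, x j * x i = q *: (x i * x j)} ->
  x j * pmono (s1 ++ j :: s2) a = q ^+ wsum s1 a *: pmono (s1 ++ j :: s2) (expo_inc a j).
Proof.
rewrite cat_uniq /= => /and3P[_ /norP[H1 _] /andP[H2 _]] Hs.
rewrite !pmono_cat !pmono_cons mulrA (qcomm_pmono _ Hs) -scalerAl !pmono_inc //.
by rewrite /expo_inc eqxx exprS !mulrA.
Qed.

Lemma rmul_pmono s1 j s2 a : uniq (s1 ++ j :: s2) ->
  {in s2, forall i, x i * x j = q *: (x j * x i)} ->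
  pmono (s1 ++ j :: s2) a * x j = q ^+ wsum s2 a *: pmono (s1 ++ j :: s2) (expo_inc a j).
Proof.
rewrite cat_uniq /= => /and3P[_ /norP[H1 _] /andP[H2 _]] Hs.
rewrite !pmono_cat !pmono_cons -!mulrA (pmono_qcomm _ Hs) -!scalerAr !pmono_inc //.
by rewrite /expo_inc eqxx exprSr !mulrA.
Qed.

(** On the way to its place x_{-p} crosses only indices below -p, never p, so each exchange is a
    q-commutation and no Omega term arises. *)
Lemma lmul_mono p a : (1 <= p <= n)%N ->
  x (- Posz p) * mono n x a =
  q ^+ wsum (range (- Posz n) (n - p)) a *: mono n x (expo_inc a (- Posz p)).
Proof.
move=> Hp; have := Iseq_uniq n; rewrite /mono -!/(pmono _ _) (Iseq_splitN Hp).
move/lmul_pmono; apply=> i; rewrite mem_range => Hi.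
by apply: relx.1; rewrite /inI; lia.
Qed.

(** The mirror case: coming from the right, x_p crosses only p + 1, ..., n. *)
Lemma rmul_mono p a : (1 <= p <= n)%N ->
  mono n x a * x (Posz p) =
  q ^+ wsum (range (Posz p.+1) (n - p)) a *: mono n x (expo_inc a (Posz p)).
Proof.
move=> Hp; have := Iseq_uniq n; rewrite /mono -!/(pmono _ _) (Iseq_splitP Hp).
move/rmul_pmono; apply=> i; rewrite mem_range => Hi.
by apply: relx.1; rewrite /inI; lia.
Qed.

End PartialMonomials.

(** * The operators on normal monomials *)

Section Operators.
Variables (k : fieldType) (A : algType k) (n : nat) (q : k) (x : int -> A).
Variables (d mu muinv : int -> A -> A).
Hypothesis q0 : q != 0.
Hypothesis q_nroot : forall m : nat, (0 < m)%N -> q ^+ m != 1.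
Hypothesis relx : qsymp_rel n q x.
Hypothesis spanx : forall u : A, exists s : seq (expo * k),
  u = \sum_(p <- s) p.2 *: mono n x p.1.
Hypothesis opsx : ops_spec n q x d mu muinv.

Let d_lin i : linear (d i). Proof. by case: opsx. Qed.
Let mu_lin i : linear (mu i). Proof. by case: opsx => _ []. Qed.
Let muinv_lin i : linear (muinv i). Proof. by case: opsx => _ [_ []]. Qed.

Lemma d_mono i a : inI n i -> d i (mono n x a) = qint q (a i) *: mono n x (expo_dec a i).
Proof. by case: opsx => _ [_ [_ [H _]]]; exact: H. Qed.
Lemma mu_mono i a : inI n i -> mu i (mono n x a) = q ^+ a i *: mono n x a.
Proof. by case: opsx => _ [_ [_ [_ [H _]]]]; exact: H. Qed.
Lemma muinv_mono i a : inI n i -> muinv i (mono n x a) = q ^- a i *: mono n x a.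
Proof. by case: opsx => _ [_ [_ [_ [_ H]]]]; exact: H. Qed.

Lemma comp_seq_linear (I : Type) (F : I -> A -> A) (s : seq I) :
  (forall i, linear (F i)) -> linear (comp_seq [seq F i | i <- s]).
Proof.
move=> F_lin; rewrite /comp_seq; elim: s => [|i s IHs] c u v //=.
by rewrite IHs F_lin.
Qed.

Lemma tauinvP_lin p : linear (tauinvP n muinv p).
Proof. exact: comp_seq_linear. Qed.
Lemma tauinvN_lin p : linear (tauinvN n muinv p).
Proof. exact: comp_seq_linear. Qed.

Lemma comp_seq_muinv_mono (g : nat -> int) s a : {in s, forall j, inI n (g j)} ->
  comp_seq [seq muinv (g j) | j <- s] (mono n x a) =
  q ^- (\sum_(j <- s) a (g j))%N *: mono n x a.
Proof.
rewrite /comp_seq; elim: s => [|j s IHs] Hs /=.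
  by rewrite big_nil expr0 invr1 scale1r.
rewrite IHs; last by move=> i Hi; apply: Hs; rewrite in_cons Hi orbT.
rewrite (linearfZ (muinv_lin _)) muinv_mono; last by apply: Hs; rewrite mem_head.
by rewrite scalerA big_cons exprD invfM mulrC.
Qed.

(** At p + 1 the block is the one of [rmul_mono], so tau_{p+1}^{-1} cancels the power of [q] created
    by right multiplication by x_p. *)
Lemma tauinvP_mono p a : (0 < p)%N ->
  tauinvP n muinv p (mono n x a) =
  q ^- wsum (range (Posz p) (n.+1 - p)) a *: mono n x a.
Proof.
move=> Hp; rewrite wsum_rangeP; apply: comp_seq_muinv_mono => j.
by rewrite mem_iota /inI => Hj; lia.
Qed.

(** Stated at p + 1 so that the block -n, ..., -p-1 is the one crossed in [lmul_mono]. *)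
Lemma tauinvN_mono p a : (p <= n)%N ->
  tauinvN n muinv p.+1 (mono n x a) =
  q ^- wsum (range (- Posz n) (n - p)) a *: mono n x a.
Proof.
move=> Hp; rewrite wsum_rangeN // -subSS; apply: comp_seq_muinv_mono => j.
by rewrite mem_iota /inI => Hj; lia.
Qed.

Lemma e_op_lin i : linear (e_op n q x d mu muinv i).
Proof.
move=> c u v; rewrite /e_op; case: eqP => _.
  rewrite !d_lin mulrDr -scalerAr mulrDl -scalerAl tauinvN_lin tauinvP_lin.
  rewrite [q ^+ 2 *: _ in LHS]scalerDr [q ^+ 2 *: (c *: _)]scalerA.
  rewrite [q ^+ 2 * c]mulrC -[(c * _) *: _]scalerA.
  rewrite addrACA -scalerDr muinv_lin scalerDr !scalerA; congr (_ *: _ + _).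
  by rewrite mulrC.
rewrite !d_lin mulrDr -scalerAr mulrDl -scalerAl tauinvN_lin tauinvP_lin.
by rewrite muinv_lin mu_lin opprD addrACA scalerBr.
Qed.

Lemma k_op_lin i : linear (k_op mu muinv i).
Proof.
move=> c u v; rewrite /k_op; case: eqP => _ /=.
  by rewrite !muinv_lin !mu_lin.
by rewrite !(muinv_lin, mu_lin).
Qed.

Lemma utri_eqP (X Y : utri A) : X.1.1 = Y.1.1 -> X.1.2 = Y.1.2 -> X.2 = Y.2 -> X = Y.
Proof. by case: X Y => [[a b] c] [[a' b'] c'] /= -> -> ->. Qed.

Lemma Omega_rec (C : algType k) (z : int -> C) m : (m <= n)%N ->
  Omega n q z m = z (- Posz m) * z (Posz m) + q *: Omega n q z m.+1.
Proof.
move=> Hm; rewrite /Omega big_ltn // subnn expr0 scale1r scaler_sumr; congr (_ + _).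
rewrite big_nat [RHS]big_nat; apply: eq_bigr => l Hl.
by rewrite scalerA -exprS -subSn //; lia.
Qed.

Lemma Omega_gt (C : algType k) (z : int -> C) m : (n < m)%N -> Omega n q z m = 0.
Proof. by move=> Hm; rewrite /Omega big_geq. Qed.

(** Downward induction on the lower summation index, in step with [Omega_rec] and starting from the
    empty sums beyond [n]. *)
Lemma Omega_ind (P : nat -> Prop) :
  (forall m, (n < m)%N -> P m) -> (forall m, (m <= n)%N -> P m.+1 -> P m) -> forall m, P m.
Proof.
move=> Pn PS m; have [N] := ubnP (n.+1 - m); elim: N m => // N IH m Hm.
have [/Pn // | Hmn] := ltnP n m.
by apply: PS => //; apply: IH; lia.
Qed.

Lemma utri_pow0 (X : A) (c : k) m :
  ((X, 0, c *: X) : utri A) ^+ m = (X ^+ m, 0, c ^+ m *: X ^+ m).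
Proof.
elim: m => [|m IHm]; first by rewrite !expr0 scale1r.
by rewrite exprS IHm utriM /= mulr0 mul0r addr0 -scalerAl -scalerAr scalerA -!exprS.
Qed.

Lemma qdiff_neq0 : q - q^-1 != 0.
Proof.
apply: contra (q_nroot (isT : 0 < 2)%N) => /eqP E.
by apply/eqP; rewrite expr2 -{2}[q](subrK q^-1) E add0r mulfV.
Qed.

Lemma qq_neq1 : q * q - 1 != 0.
Proof. by rewrite subr_eq0 -expr2 q_nroot. Qed.

Lemma qintS m : qint q m.+1 = q * qint q m + q ^- m.
Proof.
have := qdiff_neq0 => D; rewrite /qint !exprS.
have Q0 : q ^+ m != 0 by rewrite expf_neq0.
by move: (q ^+ m) Q0 => Q Q0; field; rewrite Q0 q0 qq_neq1.
Qed.

(** The corner collects the products X^j W (q^{-1} X)^{m-1-j}. Moving W to the front leaves the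
    weights q^{m-1}, q^{m-3}, ..., q^{1-m}, whose sum is the quantum integer. At m = 0 the truncated
    exponent has coefficient 0. *)
Lemma utri_pow_q (X W : A) m : X * W = q *: (W * X) ->
  ((X, W, q^-1 *: X) : utri A) ^+ m =
  (X ^+ m, qint q m *: (W * X ^+ m.-1), q ^- m *: X ^+ m).
Proof.
move=> E; elim: m => [|m IHm].
  by rewrite !expr0 /qint expr0 invr1 subrr mul0r scale0r scale1r.
rewrite exprS IHm utriM /=; congr (_, _, _); first by rewrite exprS.
  rewrite -!scalerAr qintS scalerDl; congr (_ + _).
  case: m {IHm} => [|m]; first by rewrite /qint expr0 invr1 subrr mul0r mulr0 !scale0r.
  by rewrite mulrA E -scalerAl scalerA -[W * X * _]mulrA -exprS [q * _]mulrC.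
by rewrite -scalerAl -scalerAr scalerA -exprS -invfM -exprS.
Qed.

(** * The short simple roots: e_i and k_i for i = p + 1 at least 2 *)

Section ShortRoot.
Variable p : nat.
Hypothesis Hp : (1 <= p < n)%N.

Let EN : 1 - Posz p.+1 = - Posz p. Proof. by lia. Qed.
Let EP : Posz p.+1 - 1 = Posz p. Proof. by lia. Qed.

(** The tau factors cancel the powers of [q] from inserting x_{-p-1} on the left and x_p on the
    right; only mu_p and mu_{p+1}^{-1} leave a trace. *)
Lemma e_op_mono_short a : e_op n q x d mu muinv p.+1 (mono n x a) =
  (qint q (a (- Posz p)) * q ^+ a (Posz p) * q ^- a (Posz p.+1)) *:
     mono n x (expo_inc (expo_dec a (- Posz p)) (- Posz p.+1))
  - qint q (a (Posz p.+1)) *: mono n x (expo_inc (expo_dec a (Posz p.+1)) (Posz p)).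
Proof.
rewrite /e_op; have -> : (p.+1 == 1)%N = false by lia.
rewrite EN EP !d_mono; [|rewrite /inI; lia..].
rewrite -scalerAr -scalerAl (lmul_mono relx) ?(rmul_mono relx); [|lia..].
rewrite !(linearfZ (tauinvN_lin _)) !(linearfZ (tauinvP_lin _)).
rewrite tauinvN_mono ?tauinvP_mono; [|lia..].
rewrite subSS !(linearfZ (muinv_lin _)) muinv_mono; last by rewrite /inI; lia.
rewrite !(linearfZ (mu_lin _)) mu_mono; last by rewrite /inI; lia.
rewrite !scalerA; congr (_ *: _ - _ *: _).
  rewrite wsum_inc; last by rewrite mem_range; lia.
  rewrite /expo_inc /expo_dec.
  rewrite !ifN; [|by lia..].
  by rewrite mulfK ?expf_neq0 // mulrAC.
by rewrite wsum_inc ?mulfK ?expf_neq0 // mem_range; lia.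
Qed.

Lemma k_op_mono_short a : k_op mu muinv p.+1 (mono n x a) =
  (q ^+ a (- Posz p.+1) * q ^- a (- Posz p) * q ^+ a (Posz p) * q ^- a (Posz p.+1))
    *: mono n x a.
Proof.
rewrite /k_op; have -> : (p.+1 == 1)%N = false by lia.
rewrite EN EP /= muinv_mono; last by rewrite /inI; lia.
rewrite !(linearfZ (mu_lin _)) mu_mono; last by rewrite /inI; lia.
rewrite !(linearfZ (muinv_lin _)) muinv_mono; last by rewrite /inI; lia.
rewrite !(linearfZ (mu_lin _)) mu_mono; last by rewrite /inI; lia.
by rewrite !scalerA; congr (_ *: _); ring.
Qed.

(** The values of e_{p+1} on the generators; [short_k] gives the eigenvalues of k_{p+1} there. *)
Definition short_e (i : int) : A :=
  if i == - Posz p then x (- Posz p.+1)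
  else if i == Posz p.+1 then - x (Posz p) else 0.

Definition short_k (i : int) : k :=
  if (i == - Posz p.+1) || (i == Posz p) then q
  else if (i == - Posz p) || (i == Posz p.+1) then q^-1 else 1.

Lemma short_eN : short_e (- Posz p) = x (- Posz p.+1).
Proof. by rewrite /short_e eqxx. Qed.
Lemma short_ePS : short_e (Posz p.+1) = - x (Posz p).
Proof. by rewrite /short_e eqxx ifN //; lia. Qed.
Lemma short_e0 i : i != - Posz p -> i != Posz p.+1 -> short_e i = 0.
Proof. by rewrite /short_e => /negPf -> /negPf ->. Qed.
Lemma short_kNS : short_k (- Posz p.+1) = q.
Proof. by rewrite /short_k eqxx. Qed.
Lemma short_kP : short_k (Posz p) = q.
Proof. by rewrite /short_k eqxx orbT. Qed.
Lemma short_kN : short_k (- Posz p) = q^-1.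
Proof. by rewrite /short_k eqxx ifN //; lia. Qed.
Lemma short_kPS : short_k (Posz p.+1) = q^-1.
Proof. by rewrite /short_k eqxx orbT ifN //; lia. Qed.
Lemma short_k1 i : `|i|%N != p -> `|i|%N != p.+1 -> short_k i = 1.
Proof. by move=> H1 H2; rewrite /short_k !ifN //; lia. Qed.

(** Opposite generators have opposite weights, so x_{-m} x_m and all Omega_m have weight zero. *)
Lemma short_kV m : short_k (- Posz m) * short_k (Posz m) = 1.
Proof.
have [-> | N1] := eqVneq m p; first by rewrite short_kN short_kP mulVf.
have [-> | N2] := eqVneq m p.+1; first by rewrite short_kNS short_kPS mulfV.
by rewrite !short_k1 ?mulr1 //; lia.
Qed.

Definition short_gen (i : int) : utri A := (x i, short_e i, short_k i *: x i).

(** The corners coming from the indices p and p + 1 cancel once both occur in the sum. At m = p + 1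
    only one of them occurs, and for larger m neither. *)
Lemma Omega_short_gen m : (0 < m)%N -> Omega n q short_gen m =
  (Omega n q x m, if m == p.+1 then - (x (- Posz p.+1) * x (Posz p)) else 0, Omega n q x m).
Proof.
elim/Omega_ind: m => m Hm.
  by rewrite !Omega_gt //; have -> : (m == p.+1) = false by lia.
move=> IH Hm0; rewrite !(Omega_rec _ Hm) IH // utriZ utriM utriD /=.
apply: utri_eqP => //=; last first.
  rewrite -scalerAl -scalerAr scalerA; congr (_ + _).
  by rewrite short_kV scale1r.
have [-> | N1] := eqVneq m p.+1.
  rewrite ifN; last by lia.
  by rewrite short_ePS short_e0 ?mul0r ?scaler0 ?addr0 ?mulrN //; lia.
have [-> | N2] := eqVneq m p.
  rewrite eqxx short_eN short_kP short_e0; try lia.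
  by rewrite mulr0 add0r -scalerAr -scalerDr subrr scaler0.
by rewrite ifN ?short_e0 ?mul0r ?mulr0 ?scaler0 ?addr0 //; lia.
Qed.

Let r i j : inI n i -> inI n j -> i < j -> j != - i -> x j * x i = q *: (x i * x j).
Proof. exact: relx.1. Qed.

Let r2 m : (1 <= m <= n)%N -> x (Posz m) * x (- Posz m) =
  q ^+ 2 *: (x (- Posz m) * x (Posz m)) + (q ^+ 2 * (q - q^-1)) *: Omega n q x m.+1.
Proof. exact: relx.2. Qed.

Lemma short_gen_qcomm i j : inI n i -> inI n j -> i < j -> j != - i ->
  short_gen j * short_gen i = q *: (short_gen i * short_gen j).
Proof.
move=> Hi Hj Hij Nij; rewrite !utriM utriZ /=.
apply: utri_eqP => /=; [exact: r | | ]; last first.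
  by rewrite -!scalerAl -!scalerAr (r Hi Hj Hij Nij) !scalerA; congr (_ *: _); ring.
have [Ei | Ni] := eqVneq i (- Posz p).
  rewrite Ei short_eN short_kN.
  have [Ej | Nj] := eqVneq j (Posz p.+1).
    (* The critical pair x_{p+1}, x_{-p}: its corner contains x_{p+1} x_{-p-1} and x_p x_{-p}, so
       two relations with Omega terms enter. Expanding Omega_{p+1} makes the Omega_{p+2} terms
       cancel. *)
    have /r2 r2p : (1 <= p <= n)%N by lia.
    have /r2 r2S : (1 <= p.+1 <= n)%N by lia.
    have /(Omega_rec x) OS : (p.+1 <= n)%N by lia.
    rewrite Ej short_ePS short_kPS mulNr mulrN -!scalerAr r2p r2S OS.
    move: (x _ * x _) (x _ * x _) (Omega _ _ _ _) => X Y O.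
    rewrite !scalerDr !scalerA !scalerN.
    have -> : q^-1 * (q ^+ 2 * (q - q^-1) * q) = q ^+ 2 * (q - q^-1) by field.
    have -> : q^-1 * q ^+ 2 = q by field.
    rewrite !opprD addrCA addrACA subrr addr0 -scalerBl; congr (_ + _ *: _).
    by field.
  rewrite short_e0 //; last by lia.
  rewrite short_k1; try lia.
  rewrite mul0r mulr0 addr0 add0r scale1r r //; rewrite /inI in Hi Hj *; lia.
have [Ei | Ni'] := eqVneq i (Posz p.+1).
  rewrite Ei short_ePS short_e0 ?(@short_k1 j); try lia.
  rewrite mul0r mulr0 addr0 add0r scale1r mulrN mulNr scalerN r //; rewrite /inI in Hi Hj *; lia.
rewrite (short_e0 Ni Ni') mul0r mulr0 addr0 add0r.
have [Ej | Nj] := eqVneq j (- Posz p).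
  rewrite Ej short_eN; have [Ei | Ni2] := eqVneq i (- Posz p.+1).
    by rewrite Ei short_kNS -scalerAr.
  rewrite short_k1; try lia.
  rewrite scale1r r //; rewrite /inI in Hi Hj *; lia.
have [Ej | Nj'] := eqVneq j (Posz p.+1); last by rewrite short_e0 // mul0r mulr0 scaler0.
rewrite Ej short_ePS mulNr mulrN scalerN; congr (- _).
have [Ei | Ni2] := eqVneq i (Posz p); first by rewrite Ei short_kP -scalerAr.
rewrite short_k1; try lia.
rewrite scale1r r //; rewrite /inI in Hi Hj *; lia.
Qed.

Lemma short_gen_rel : qsymp_rel n q short_gen.
Proof.
split=> [|i Hi]; first exact: short_gen_qcomm.
rewrite Omega_short_gen // !utriM !utriZ utriD /=.
apply: utri_eqP => /=; [exact: r2 | | ]; last first.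
  have K := short_kV i; have K' : short_k (Posz i) * short_k (- Posz i) = 1 by rewrite mulrC.
  rewrite -!scalerAl -!scalerAr !scalerA -[q ^+ 2 * _ * _]mulrA ?K ?K' mulr1 scale1r.
  by rewrite r2.
(* Here the nonzero corner of Omega_{p+1} is needed: it lowers the coefficient of x_{-p-1} x_p from
   q^3 to q. *)
have [Ei | Ni] := eqVneq i p.
  rewrite Ei eqxx short_eN short_kP short_e0; try lia.
  rewrite mul0r mulr0 addr0 add0r (@r (- Posz p.+1) (Posz p)); try (rewrite /inI; lia).
  rewrite -scalerAr scalerA scalerN -scaleNr -scalerDl; congr (_ *: _).
  by field.
have [Ei | Ni'] := eqVneq i p.+1.
  rewrite Ei ifN ?short_ePS ?short_kNS ?(@short_e0 (- Posz p.+1)); try lia.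
  rewrite mul0r mulr0 addr0 add0r scaler0 addr0 mulrN scalerN mulNr -scalerAr.
  rewrite (@r (- Posz p.+1) (Posz p)); try (rewrite /inI; lia).
  by rewrite scalerA.
rewrite ifN; last by lia.
by rewrite !short_e0; try lia; rewrite !mul0r !mulr0 !addr0 !scaler0 addr0.
Qed.

Lemma short_gen_diag s a : {in s, forall i, `|i|%N != p /\ `|i|%N != p.+1} ->
  \prod_(i <- s) short_gen i ^+ a i = (pmono x s a, 0, pmono x s a) :> utri A.
Proof.
rewrite /pmono; elim: s => [|i s IHs] Hs; first by rewrite !big_nil.
rewrite !big_cons IHs; last by move=> j Hj; apply: Hs; rewrite in_cons Hj orbT.
have [H1 H2] := Hs i (mem_head _ _).
rewrite /short_gen short_e0 ?short_k1; try lia.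
by rewrite utri_pow0 utriM /= mulr0 mul0r addr0 expr1n scale1r.
Qed.

Let sC := range (1 - Posz p) p.-1 ++ range 1 p.-1.

Lemma mono_split4 (C : algType k) (z : int -> C) b : mono n z b =
  pmono z (range (- Posz n) (n - p.+1)) b *
  (z (- Posz p.+1) ^+ b (- Posz p.+1) * z (- Posz p) ^+ b (- Posz p)) * pmono z sC b *
  (z (Posz p) ^+ b (Posz p) * z (Posz p.+1) ^+ b (Posz p.+1)) *
  pmono z (range (Posz p.+2) (n - p.+1)) b.
Proof.
rewrite /mono -/(pmono _ _ _) (Iseq_split4 Hp).
by rewrite !(pmono_cat, pmono_cons) !pmono_nil !mulr1 !mulrA.
Qed.

(** Only the powers of x_{-p} and x_{p+1} have a corner, which gives the two terms of e_{p+1}.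
    Factors to the right of a corner enter through their last entries; this yields q^{a_p - a_{p+1}}
    in the first term and 1 in the second. *)
Lemma mono_short_gen a :
  mono n short_gen a = (mono n x a, e_op n q x d mu muinv p.+1 (mono n x a),
                 k_op mu muinv p.+1 (mono n x a)).
Proof.
have Y1 m : short_gen (- Posz p.+1) ^+ m =
    (x (- Posz p.+1) ^+ m, 0, q ^+ m *: x (- Posz p.+1) ^+ m).
  by rewrite /short_gen short_kNS short_e0 ?utri_pow0 //; lia.
have Y2 m : short_gen (- Posz p) ^+ m = (x (- Posz p) ^+ m,
    qint q m *: (x (- Posz p.+1) * x (- Posz p) ^+ m.-1), q ^- m *: x (- Posz p) ^+ m).
  by rewrite /short_gen short_kN short_eN utri_pow_q // r //; rewrite /inI; lia.
have Y3 m : short_gen (Posz p) ^+ m = (x (Posz p) ^+ m, 0, q ^+ m *: x (Posz p) ^+ m).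
  by rewrite /short_gen short_kP short_e0 ?utri_pow0 //; lia.
have Y4 m : short_gen (Posz p.+1) ^+ m = (x (Posz p.+1) ^+ m,
    qint q m *: (- x (Posz p) * x (Posz p.+1) ^+ m.-1), q ^- m *: x (Posz p.+1) ^+ m).
  rewrite /short_gen short_kPS short_ePS utri_pow_q // mulrN mulNr scalerN r //; rewrite /inI; lia.
rewrite e_op_mono_short k_op_mono_short !mono_split4.
rewrite /pmono !short_gen_diag; try (move=> i; rewrite ?mem_cat !mem_range; lia).
rewrite -!/(pmono _ _ _).
rewrite !pmono_inc ?pmono_dec; try (rewrite ?mem_cat !mem_range; lia).
rewrite /expo_inc /expo_dec !eqxx.
repeat match goal with |- context [if ?b then _ else _] => rewrite (_ : b = false); [|lia] end.
rewrite Y1 Y2 Y3 Y4 !utriM /= !(mul0r, mulr0, addr0, add0r).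
set P := pmono x _ a; set C := pmono x sC a; set R := pmono x _ a.
congr (_, _, _).
  rewrite mulrDl addrC; congr (_ + _).
    rewrite exprSr -!(scalerAl, scalerAr) !scalerA !mulrA.
    by congr (_ *: _); ring.
  rewrite exprSr mulNr -scaleNr !(scalerN, mulrN, mulNr) scaleNr.
  by rewrite -!(scalerAl, scalerAr) !mulrA.
rewrite -!(scalerAl, scalerAr) !scalerA !mulrA.
by congr (_ *: _); ring.
Qed.

Definition etriple (i : nat) (u : A) : utri A :=
  (u, e_op n q x d mu muinv i u, k_op mu muinv i u).

Lemma etriple_lin i : linear (etriple i).
Proof.
by move=> c u v; rewrite /etriple (@e_op_lin i c) (@k_op_lin i c) utriZ utriD.
Qed.

Lemma etripleM_short u v : etriple p.+1 (u * v) = etriple p.+1 u * etriple p.+1 v.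
Proof.
by apply: (phiM relx short_gen_rel (etriple_lin _) _ spanx) => a; rewrite mono_short_gen.
Qed.

Lemma etriple1_short : etriple p.+1 1 = 1.
Proof. by apply: (@phi1 _ n _ _ x short_gen) => a; rewrite mono_short_gen. Qed.

End ShortRoot.

(** * The long simple root: e_1 and k_1 *)

Section LongRoot.
Hypothesis Hn : (2 <= n)%N.

Let r i j : inI n i -> inI n j -> i < j -> j != - i -> x j * x i = q *: (x i * x j).
Proof. exact: relx.1. Qed.

Let X1 := x 1.
Let XN := x (-1).
Let O := Omega n q x 2.

Lemma X1XN : X1 * XN = q ^+ 2 *: (XN * X1) + (q ^+ 2 * (q - q^-1)) *: O.
Proof. by apply: (relx.2 1%N); lia. Qed.

(** The factor q from crossing x_{-l} and the factor q^{-1} from crossing x_l cancel in each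
    term. *)
Lemma X1O : X1 * O = O * X1.
Proof.
rewrite /O /Omega mulr_sumr mulr_suml big_nat [RHS]big_nat; apply: eq_bigr => l Hl.
rewrite -scalerAr -scalerAl; congr (_ *: _).
rewrite mulrA (@r (- Posz l) 1); try (rewrite /inI; lia).
rewrite -[RHS]mulrA (@r 1 (Posz l)); try (rewrite /inI; lia).
by rewrite -scalerAl -scalerAr mulrA.
Qed.

(** The Omega coefficient is the geometric sum of q^2 (q - q^{-1}) q^{2j} over j < m. *)
Lemma X1powXN m : X1 ^+ m * XN =
  q ^+ m.*2 *: (XN * X1 ^+ m) + (q * (q ^+ m.*2 - 1)) *: (O * X1 ^+ m.-1).
Proof.
elim: m => [|m IHm].
  by rewrite !expr0 subrr mulr0 scale0r addr0 scale1r mulr1 mul1r.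
rewrite [X1 ^+ m.+1]exprS -mulrA IHm mulrDr -!scalerAr [X1 * (XN * _)]mulrA X1XN mulrDl -!scalerAl.
rewrite -[XN * X1 * _]mulrA.
rewrite scalerDr !scalerA -addrA; congr (_ + _).
  by congr (_ *: _); rewrite doubleS !exprS; ring.
(* At m = 0 the truncated exponent is harmless because the coefficient vanishes. *)
have -> : (q * (q ^+ m.*2 - 1)) *: (X1 * (O * X1 ^+ m.-1)) = (q * (q ^+ m.*2 - 1)) *: (O * X1 ^+ m).
  case: m {IHm} => [|m]; first by rewrite expr0 subrr mulr0 !scale0r.
  by rewrite mulrA X1O -mulrA -exprS.
rewrite -scalerDl; congr (_ *: _); rewrite doubleS !exprS; move: (q ^+ _) => Q.
by field.
Qed.

(** The quantum integer [m] at q^2: the coefficient of x_{-1} x_1^{m-1} in e_1(x_1^m). *)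
Definition gcoef m : k := qint q m.*2 / qint q 2.
(** Equal to q^2 (q - q^{-1}) [m] [m-1] / [2]: the coefficient of Omega_2 x_1^{m-2} in
    e_1(x_1^m). *)
Definition hcoef m : k := qint q m / qint q 2 * (q * (q ^+ m - q ^+ 2 * q ^- m)).

(** Ensures that the denominator [2] is nonzero. *)
Lemma q4_neq1 : q * q * (q * q) - 1 != 0.
Proof. by rewrite subr_eq0 -!expr2 -exprM (q_nroot (isT : 0 < 4)%N). Qed.

Lemma gcoefS m : gcoef m.+1 = q ^+ 2 * gcoef m + q ^- m.*2.
Proof.
rewrite /gcoef /qint doubleS !exprS expr0.
have Q0 : q ^+ m.*2 != 0 by rewrite expf_neq0.
by move: (q ^+ _) Q0 => Q Q0; field; rewrite Q0 q0 qq_neq1 q4_neq1.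
Qed.

Lemma hcoefS m : hcoef m.+1 = q ^+ 2 * (q - q^-1) * gcoef m + hcoef m.
Proof.
rewrite /hcoef /gcoef /qint -addnn exprD !exprS expr0.
have Q0 : q ^+ m != 0 by rewrite expf_neq0.
by move: (q ^+ _) Q0 => Q Q0; field; rewrite Q0 q0 qq_neq1 q4_neq1.
Qed.

Lemma hcoef0 : hcoef 0 = 0.
Proof. by rewrite /hcoef /qint expr0 invr1 subrr !mul0r. Qed.

Lemma hcoef1 : hcoef 1 = 0.
Proof. by rewrite /hcoef expr1 expr2 mulfK // subrr !mulr0. Qed.

(* The junk exponents [m.-1], [m.-2] for [m < 2] come with zero coefficients. *)
Lemma utri_pow_long m : ((X1, XN, q ^- 2 *: X1) : utri A) ^+ m =
  (X1 ^+ m, gcoef m *: (XN * X1 ^+ m.-1) + hcoef m *: (O * X1 ^+ m.-2),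
   q ^- m.*2 *: X1 ^+ m).
Proof.
elim: m => [|m IHm].
  by rewrite !expr0 hcoef0 /gcoef /qint expr0 invr1 subrr !mul0r !scale0r addr0 scale1r.
rewrite exprS IHm utriM /=; congr (_, _, _); first by rewrite exprS.
  have -> : X1 * (gcoef m *: (XN * X1 ^+ m.-1) + hcoef m *: (O * X1 ^+ m.-2)) =
      (q ^+ 2 * gcoef m) *: (XN * X1 ^+ m) +
      (q ^+ 2 * (q - q^-1) * gcoef m + hcoef m) *: (O * X1 ^+ m.-1).
    case: m {IHm} => [|m].
      by rewrite hcoef0 /gcoef /qint expr0 invr1 subrr !mul0r !mulr0 addr0 !scale0r addr0 mulr0.
    rewrite mulrDr -!scalerAr [X1 * (XN * _)]mulrA X1XN mulrDl -!scalerAl scalerDr !scalerA.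
    rewrite -[XN * X1 * _]mulrA -exprS -addrA [gcoef _ * q ^+ 2]mulrC; congr (_ + _).
    rewrite scalerDl [gcoef _ * _]mulrC; congr (_ + _).
    case: m => [|m]; first by rewrite hcoef1 !scale0r.
    by rewrite mulrA X1O -mulrA -exprS.
  rewrite -scalerAr addrAC -scalerDl -gcoefS -hcoefS //.
by rewrite -scalerAl -scalerAr scalerA -exprS -invfM -exprD.
Qed.

Let PN := range (- Posz n) n.
Let PP := range 1 n.

Lemma wsum_inc1 s a j : uniq s -> j \in s -> wsum s (expo_inc a j) = (wsum s a).+1.
Proof.
move=> Us Hj; rewrite /wsum (bigD1_seq j) //= [in RHS](bigD1_seq j) //=.
rewrite {1}/expo_inc eqxx addSn; congr (_ + _).+1.
by apply: eq_bigr => i /negPf Hi; rewrite /expo_inc Hi.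
Qed.

(** Each term x_{-l} x_l of Omega_2 raises exactly one exponent among 2, ..., n, so all terms share
    one weight; this is the [.+1]. *)
Lemma Omega_tau_weight b :
  muinv 1 (tauinvP n muinv 2 (pmono x PN b * O * pmono x PP b)) =
  (q ^- b 1 * q ^- (wsum (range 2 n.-1) b).+1) *: (pmono x PN b * O * pmono x PP b).
Proof.
rewrite {1 2}/O /Omega mulr_sumr mulr_suml.
rewrite (linearf_sum (tauinvP_lin _)) (linearf_sum (muinv_lin _)) scaler_sumr.
rewrite big_nat [RHS]big_nat; apply: eq_bigr => l Hl.
rewrite -!scalerAr -!scalerAl (linearfZ (tauinvP_lin _)) (linearfZ (muinv_lin _)).
rewrite !scalerA [_ * q ^+ (l - 2)]mulrC -scalerA; congr (_ *: _).
(* x_{-l} moves left into the negative block and x_l right into the positive one, each crossing only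
   indices of smaller absolute value. The resulting scalar is common to both sides and can stay
   unspecified. *)
have [c ->] : exists c, pmono x PN b * (x (- Posz l) * x (Posz l)) * pmono x PP b =
    c *: mono n x (expo_inc (expo_inc b (- Posz l)) (Posz l)).
  have HN : PN = range (- Posz n) (n - l) ++ - Posz l :: range (1 - Posz l) l.-1.
    rewrite /PN (@range_split _ _ (- Posz l) (n - l) l); try lia.
    by rewrite (@range_cons (- Posz l) l (1 - Posz l) l.-1) //; lia.
  have HP : PP = range 1 l.-1 ++ Posz l :: range (Posz l.+1) (n - l).
    rewrite /PP (@range_split _ _ (Posz l) l.-1 (n - l).+1); try lia.
    by rewrite (@range_cons (Posz l) _ (Posz l.+1) (n - l)) //; lia.
  have UN : uniq PN by exact: range_uniq.
  have UP : uniq PP by exact: range_uniq.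
  have EN : pmono x PN b * x (- Posz l) =
      q ^+ wsum (range (1 - Posz l) l.-1) b *: pmono x PN (expo_inc b (- Posz l)).
    rewrite HN in UN *; apply: (rmul_pmono _ UN) => i; rewrite mem_range => Hi.
    by apply: r; rewrite /inI; lia.
  have EP : x (Posz l) * pmono x PP b =
      q ^+ wsum (range 1 l.-1) b *: pmono x PP (expo_inc b (Posz l)).
    rewrite HP in UP *; apply: (lmul_pmono _ UP) => i; rewrite mem_range => Hi.
    by apply: r; rewrite /inI; lia.
  rewrite mulrA -[_ * x (Posz l) * _]mulrA EN EP -scalerAl -scalerAr scalerA.
  eexists; congr (_ *: _).
  rewrite /mono -/(pmono _ _ _) IseqE pmono_cat -/PN -/PP.
  rewrite (@pmono_inc _ _ _ PN _ (Posz l)); last by rewrite mem_range; lia.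
  congr (_ * _); apply: eq_pmono => i; rewrite mem_range => Hi.
  by rewrite /expo_inc; case: ifP => // _; rewrite ifN //; lia.
rewrite !(linearfZ (tauinvP_lin _), linearfZ (muinv_lin _)) tauinvP_mono //.
rewrite (linearfZ (muinv_lin _)) muinv_mono; last by rewrite /inI; lia.
rewrite !scalerA; congr (_ *: _).
rewrite [X in q ^- wsum X _](_ : _ = range 2 n.-1); last by congr range; lia.
rewrite wsum_inc1 ?range_uniq ?mem_range; try lia.
rewrite wsum_inc ?mem_range; try lia.
rewrite /expo_inc !ifN; try lia.
by ring.
Qed.

Let PP2 := range 2 n.-1.

Lemma pmono_PP (C : algType k) (z : int -> C) b : pmono z PP b = z 1 ^+ b 1 * pmono z PP2 b.
Proof. by rewrite /PP (@range_cons 1 n 2 n.-1) ?pmono_cons //; lia. Qed.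

Lemma pmono_PN (C : algType k) (z : int -> C) b :
  pmono z PN b = pmono z (range (- Posz n) n.-1) b * z (-1) ^+ b (-1).
Proof.
rewrite /PN (@range_split _ _ (-1) n.-1 1) ?pmono_cat ?range1 ?pmono_cons ?pmono_nil ?mulr1 //; lia.
Qed.

Lemma mono_PNPP (C : algType k) (z : int -> C) b : mono n z b = pmono z PN b * pmono z PP b.
Proof. by rewrite /mono -/(pmono _ _ _) IseqE pmono_cat. Qed.

(** From the right, x_{-1} first q-commutes past x_n, ..., x_2 and then meets the power of x_1,
    where Omega_2 appears. *)
Lemma mono_rmulXN b : mono n x b * XN =
  q ^+ wsum PP2 b *: (q ^+ (b 1).*2 *: mono n x (expo_inc b (-1)) +
    (q * (q ^+ (b 1).*2 - 1)) *: (pmono x PN b * O * pmono x PP (expo_dec b 1))).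
Proof.
rewrite mono_PNPP pmono_PP -!mulrA (@pmono_qcomm _ _ q x PP2 b XN); last first.
  by move=> i; rewrite mem_range => Hi; apply: r; rewrite /inI; lia.
rewrite -!scalerAr [x 1 ^+ _ * _]mulrA -/X1 X1powXN mulrDl mulrDr -!scalerAl -!scalerAr.
rewrite mono_PNPP !pmono_PN !pmono_PP !pmono_inc ?pmono_dec; try (rewrite mem_range; lia).
rewrite /expo_inc /expo_dec !eqxx -/X1 -/XN.
rewrite (_ : (1 == -1 :> int) = false); last by lia.
by rewrite exprSr !mulrA.
Qed.

(** Left and right multiplication by x_{-1} together produce [gcoef]; the Omega term, hence [hcoef],
    comes from the right multiplication alone. *)
Lemma e_op_mono_long a : e_op n q x d mu muinv 1 (mono n x a) =
  gcoef (a 1) *: mono n x (expo_inc (expo_dec a 1) (-1)) +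
  hcoef (a 1) *: (pmono x PN a * O * pmono x PP (expo_dec (expo_dec a 1) 1)).
Proof.
rewrite /e_op eqxx d_mono; last by rewrite /inI; lia.
set b := expo_dec a 1.
have b1 : b 1 = (a 1).-1 by rewrite /b /expo_dec eqxx.
rewrite -scalerAr -scalerAl mono_rmulXN (@lmul_mono _ _ _ _ _ relx 1); last by lia.
rewrite !(linearfZ (tauinvN_lin _)) tauinvN_mono; last by lia.
rewrite wsum_inc; last by rewrite mem_range; lia.
set M := mono n x (expo_inc b (-1)).
have EPN c : pmono x PN (expo_dec c 1) = pmono x PN c.
  by rewrite pmono_dec // mem_range; lia.
have -> : pmono x PN a = pmono x PN b by rewrite EPN.
set E := pmono x PN b * O * _.
have MM : muinv 1 M = q ^- b 1 *: M.
  rewrite muinv_mono; last by rewrite /inI; lia.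
  by rewrite /expo_inc (_ : (1 == -1 :> int) = false).
have TM : muinv 1 (tauinvP n muinv 2 M) = (q ^- wsum PP2 b * q ^- b 1) *: M.
  rewrite tauinvP_mono // (linearfZ (muinv_lin _)) MM scalerA wsum_inc; last first.
    by rewrite mem_range; lia.
  by congr (_ * _ *: _); congr (q ^- wsum (range _ _) _); lia.
have TE : muinv 1 (tauinvP n muinv 2 E) = (q ^- (b 1).-1 * q ^- (wsum PP2 b).+1) *: E.
  (* Lowering the exponent of x_1 does not touch the negative block, so the weight formula applies
     at [expo_dec b 1]. *)
  have -> : E = pmono x PN (expo_dec b 1) * O * pmono x PP (expo_dec b 1) by rewrite EPN.
  rewrite Omega_tau_weight; congr (_ * q ^- _.+1 *: _).
  by apply: eq_big_seq => i; rewrite mem_range /expo_dec => Hi; rewrite ifN //; lia.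
rewrite !scalerDr !scalerA.
rewrite !(linearfD (tauinvP_lin _), linearfZ (tauinvP_lin _)) scalerDr !scalerA.
rewrite !(linearfD (muinv_lin _), linearfZ (muinv_lin _)) MM TM TE.
rewrite !scalerDr !scalerA addrA -scalerDl b1.
move: M E {MM TM TE} (wsum PP2 b) (wsum _ b) => M E w w'.
have w0 : q ^+ w != 0 by rewrite expf_neq0.
rewrite mulfK ?expf_neq0 // [q ^+ w.+1]exprS; move: (q ^+ w) w0 => W W0.
congr (_ *: _ + _ *: _).
  case: (a 1) => [|m]; first by rewrite /gcoef /qint expr0 invr1 subrr !(mul0r, mulr0) addr0.
  rewrite /gcoef /qint doubleS -addnn !exprS exprD expr0 /=.
  have Q0 : q ^+ m != 0 by rewrite expf_neq0.
  by move: (q ^+ m) Q0 => Q Q0; field; rewrite q0 qq_neq1 q4_neq1 Q0 W0.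
(* For exponents 0 and 1 the truncated predecessors are meaningless, but both coefficients
   vanish. *)
case: (a 1) => [|[|m]]; first by rewrite hcoef0 /qint expr0 invr1 subrr !(mul0r, mulr0).
  by rewrite hcoef1 expr0 subrr !(mul0r, mulr0).
rewrite /hcoef /qint /= doubleS -addnn !exprS exprD expr0.
have Q0 : q ^+ m != 0 by rewrite expf_neq0.
by move: (q ^+ m) Q0 => Q Q0; field; rewrite Q0 q0 qq_neq1 q4_neq1 W0.
Qed.

Let sP := range (- Posz n) n.-1.

Lemma mono_split2 (C : algType k) (z : int -> C) b : mono n z b =
  pmono z sP b * (z (-1) ^+ b (-1) * z 1 ^+ b 1) * pmono z PP2 b.
Proof. by rewrite mono_PNPP pmono_PN pmono_PP !mulrA. Qed.

Lemma k_op_mono_long a : k_op mu muinv 1 (mono n x a) =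
  (q ^+ (a (-1)).*2 * q ^- (a 1).*2) *: mono n x a.
Proof.
rewrite /k_op eqxx /=.
do 2 (rewrite ?(linearfZ (muinv_lin _)) muinv_mono; last by rewrite /inI; lia).
do 2 (rewrite !(linearfZ (mu_lin _)) mu_mono; last by rewrite /inI; lia).
by rewrite !scalerA -!addnn !exprD invfM; congr (_ *: _); ring.
Qed.

(** The values of e_1 on the generators; [long_k] gives the eigenvalues of k_1 there. *)
Definition long_e (i : int) : A := if i == 1 then XN else 0.
Definition long_k (i : int) : k := if i == -1 then q ^+ 2 else if i == 1 then q ^- 2 else 1.
Definition long_gen (i : int) : utri A := (x i, long_e i, long_k i *: x i).

Lemma long_e0 i : i != 1 -> long_e i = 0.
Proof. by rewrite /long_e => /negPf ->. Qed.
Lemma long_k1 i : `|i|%N != 1%N -> long_k i = 1.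
Proof. by move=> Hi; rewrite /long_k !ifN //; lia. Qed.

Lemma Omega_long_gen m : (1 < m)%N -> Omega n q long_gen m = (Omega n q x m, 0, Omega n q x m).
Proof.
elim/Omega_ind: m => m Hm; first by rewrite !Omega_gt.
move=> IH Hm0; rewrite !(Omega_rec _ Hm) IH; last by lia.
rewrite /long_gen !long_e0 ?long_k1; try lia.
by rewrite !scale1r utriZ utriM utriD /= !(mulr0, mul0r, addr0, scaler0).
Qed.

Lemma long_gen_rel : qsymp_rel n q long_gen.
Proof.
split=> [i j Hi Hj Hij Nij | i Hi].
  rewrite !utriM utriZ /=; apply: utri_eqP => /=; [exact: r | | ]; last first.
    by rewrite -!scalerAl -!scalerAr (r Hi Hj Hij Nij) !scalerA; congr (_ *: _); ring.
  have [Ei | Ni] := eqVneq i 1.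
    rewrite Ei (@long_e0 j) ?(@long_k1 j); try lia.
    rewrite mul0r mulr0 addr0 add0r scale1r; apply: r; rewrite /inI in Hi Hj *; lia.
  rewrite (long_e0 Ni) mul0r mulr0 addr0 add0r.
  have [Ej | Nj] := eqVneq j 1; last by rewrite long_e0 // mul0r mulr0 scaler0.
  rewrite long_k1 ?scale1r; last by lia.
  by rewrite Ej /long_e eqxx; apply: r; rewrite /inI in Hi Hj *; lia.
rewrite Omega_long_gen; last by lia.
rewrite !utriM !utriZ utriD /=.
have K : long_k (- Posz i) * long_k (Posz i) = 1.
  have [-> | Ni] := eqVneq i 1%N; last by rewrite !long_k1 ?mulr1 //; lia.
  by rewrite /long_k /= mulfV ?expf_neq0.
apply: utri_eqP => /=; first exact: relx.2.
  have [-> | Ni] := eqVneq i 1%N.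
    rewrite (@long_e0 (- 1%:Z)) //; rewrite mulr0 mul0r add0r addr0 scaler0 addr0.
    by rewrite /long_e /long_k /= -scalerAr.
  by rewrite !long_e0; try lia; rewrite !(mulr0, mul0r, addr0, scaler0).
have K' : long_k (Posz i) * long_k (- Posz i) = 1 by rewrite mulrC.
rewrite -!scalerAl -!scalerAr !scalerA -[q ^+ 2 * _ * _]mulrA ?K ?K' mulr1 scale1r.
by apply: relx.2.
Qed.

Lemma long_gen_diag s a : {in s, forall i, `|i|%N != 1%N} ->
  pmono long_gen s a = (pmono x s a, 0, pmono x s a).
Proof.
rewrite /pmono; elim: s => [|i s IHs] Hs; first by rewrite !big_nil.
rewrite !big_cons IHs; last by move=> j Hj; apply: Hs; rewrite in_cons Hj orbT.
have H1 := Hs i (mem_head _ _).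
rewrite /long_gen long_e0 ?long_k1; try lia.
by rewrite utri_pow0 utriM /= mulr0 mul0r addr0 expr1n scale1r.
Qed.

(** Only the power of x_1 has a corner. The factors to its left enter with their first entries, and
    those to its right are diagonal with equal entries. *)
Lemma mono_long_gen a :
  mono n long_gen a = (mono n x a, e_op n q x d mu muinv 1 (mono n x a),
                 k_op mu muinv 1 (mono n x a)).
Proof.
have Y1 m : long_gen (-1) ^+ m = (XN ^+ m, 0, q ^+ m.*2 *: XN ^+ m).
  by rewrite /long_gen long_e0 // /long_k eqxx utri_pow0 -exprM mul2n.
have Y2 m : long_gen 1 ^+ m = (X1 ^+ m,
    gcoef m *: (XN * X1 ^+ m.-1) + hcoef m *: (O * X1 ^+ m.-2), q ^- m.*2 *: X1 ^+ m).
  by rewrite -utri_pow_long.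
rewrite e_op_mono_long k_op_mono_long !mono_split2 pmono_PN pmono_PP.
rewrite !long_gen_diag; try (move=> i; rewrite mem_range; lia).
rewrite !pmono_inc ?pmono_dec; try (rewrite mem_range; lia).
rewrite /expo_inc /expo_dec !eqxx.
repeat match goal with |- context [if ?b then _ else _] => rewrite (_ : b = false); [|lia] end.
rewrite Y1 Y2 !utriM /= !(mul0r, mulr0, addr0, add0r) -/X1 -/XN.
set P := pmono x _ a; set S := pmono x _ a.
congr (_, _, _).
  by rewrite exprSr !mulrDr mulrDl -!(scalerAl, scalerAr) !mulrA.
by rewrite -!(scalerAl, scalerAr) scalerA mulrC.
Qed.

Lemma etripleM_long u v : etriple 1 (u * v) = etriple 1 u * etriple 1 v.
Proof. by apply: (phiM relx long_gen_rel (etriple_lin _) _ spanx) => a; rewrite mono_long_gen. Qed.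

Lemma etriple1_long : etriple 1 1 = 1.
Proof. by apply: (@phi1 _ n _ _ x long_gen) => a; rewrite mono_long_gen. Qed.

End LongRoot.

(** * Product rules for all e_i and k_i, read off the matrix entries *)

Lemma etripleM i u v : (2 <= n)%N -> (1 <= i <= n)%N ->
  etriple i (u * v) = etriple i u * etriple i v.
Proof.
case: i => [|[|p]] // Hn Hi; first exact: etripleM_long.
by apply: etripleM_short; lia.
Qed.

Lemma etriple1 i : (2 <= n)%N -> (1 <= i <= n)%N -> etriple i 1 = 1.
Proof.
case: i => [|[|p]] // Hn Hi; first exact: etriple1_long.
by apply: etriple1_short; lia.
Qed.

Lemma e_op_M i u v : (2 <= n)%N -> (1 <= i <= n)%N ->
  e_op n q x d mu muinv i (u * v) =
  e_op n q x d mu muinv i u * k_op mu muinv i v + u * e_op n q x d mu muinv i v.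
Proof.
move=> Hn Hi; have := etripleM u v Hn Hi => /(congr1 (fun X => X.1.2)) /= ->.
by rewrite addrC.
Qed.

Lemma k_op_M i u v : (2 <= n)%N -> (1 <= i <= n)%N ->
  k_op mu muinv i (u * v) = k_op mu muinv i u * k_op mu muinv i v.
Proof. by move=> Hn Hi; have := etripleM u v Hn Hi => /(congr1 (fun X => X.2)). Qed.

Lemma e_op_1 i : (2 <= n)%N -> (1 <= i <= n)%N -> e_op n q x d mu muinv i 1 = 0.
Proof. by move=> Hn Hi; have := etriple1 Hn Hi => /(congr1 (fun X => X.1.2)). Qed.

Lemma k_op_1 i : (2 <= n)%N -> (1 <= i <= n)%N -> k_op mu muinv i 1 = 1.
Proof. by move=> Hn Hi; have := etriple1 Hn Hi => /(congr1 (fun X => X.2)). Qed.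

End Operators.

(** * The converse algebra and the module algebra axioms *)

Section ModuleAlgebra.
Variables (k : fieldType) (A : algType k) (n : nat) (q : k) (x : int -> A).
Variables (d mu muinv : int -> A -> A).
Hypothesis q0 : q != 0.
Hypothesis q_nroot : forall m : nat, (0 < m)%N -> q ^+ m != 1.
Hypothesis Hn : (2 <= n)%N.
Hypothesis relx : qsymp_rel n q x.
Hypothesis spanx : forall u : A, exists s : seq (expo * k),
  u = \sum_(p <- s) p.2 *: mono n x p.1.
Hypothesis opsx : ops_spec n q x d mu muinv.

Local Notation C := (convalg A).
Let xr : int -> C := fun i => x (- i).
Let dr : int -> C -> C := fun i => d (- i).
Let mur : int -> C -> C := fun i => mu (- i).
Let muinvr : int -> C -> C := fun i => muinv (- i).

Lemma convM (u v : C) : u * v = ((v : A) * (u : A)). Proof. by []. Qed.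

Lemma convX (u : C) m : u ^+ m = (u : A) ^+ m :> A.
Proof. by elim: m => // m IHm; rewrite exprS exprSr convM IHm. Qed.

Lemma conv_prod (s : seq int) (F : int -> A) :
  \prod_(i <- rev s) (F i : C) = \prod_(i <- s) F i :> A.
Proof.
elim: s => [|i s IHs]; first by rewrite !big_nil.
by rewrite rev_cons big_rcons /= convM IHs big_cons.
Qed.

Lemma inIN i : inI n (- i) = inI n i. Proof. by rewrite /inI; lia. Qed.

Lemma rev_Iseq : Iseq n = rev [seq - i | i <- Iseq n].
Proof.
apply: (@sorted_eq _ <=%R); first exact: le_trans.
- exact: le_anti.
- by move: (Iseq_sorted n); apply: sub_sorted => i j; exact: ltW.
- rewrite rev_sorted sorted_map; move: (Iseq_sorted n).
  by apply: sub_sorted => i j /=; rewrite lerN2; exact: ltW.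
rewrite perm_sym perm_rev; apply: uniq_perm; rewrite ?Iseq_uniq //.
  by rewrite map_inj_uniq ?Iseq_uniq //; exact: oppr_inj.
move=> i; rewrite mem_Iseq; apply/mapP/idP => [[j] | Hi].
  by rewrite mem_Iseq => Hj ->; rewrite inIN.
by exists (- i); rewrite ?opprK // mem_Iseq inIN.
Qed.

(** Negation reverses the order of the indices and the opposite algebra reverses the factors; the
    two reversals cancel. *)
Lemma mono_rev (a : expo) : mono n xr a = mono n x (fun i => a (- i)).
Proof.
rewrite /mono [in LHS]rev_Iseq.
rewrite (eq_bigr (fun i : int => ((x (- i) : A) ^+ a i : C))); last by move=> i _; rewrite convX.
by rewrite conv_prod big_map; apply: eq_bigr => i _; rewrite opprK.
Qed.

Lemma eq_mono (B : algType k) (y : int -> B) (a b : expo) : a =1 b -> mono n y a = mono n y b.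
Proof. by move=> E; apply: eq_bigr => i _; rewrite E. Qed.

Lemma Omega_rev m : Omega n q xr m = Omega n q x m.
Proof. by rewrite /Omega; apply: eq_bigr => j _; rewrite /xr convM opprK. Qed.

(** For i < j both the indices and the factors are reversed, while x_i x_{-i} and every term of
    Omega are fixed. *)
Lemma rel_rev : qsymp_rel n q xr.
Proof.
split=> [i j Hi Hj Hij Nij | i Hi].
  by rewrite !convM; apply: relx.1; rewrite ?inIN //; lia.
by rewrite Omega_rev !convM /xr opprK; exact: (relx.2 i).
Qed.

Lemma span_rev (u : C) : exists s : seq (expo * k), u = \sum_(p <- s) p.2 *: mono n xr p.1.
Proof.
have [s Es] := spanx u; exists [seq ((fun i => p.1 (- i)) : expo, p.2) | p <- s].
rewrite big_map [LHS]Es; apply: eq_bigr => p _.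
by rewrite mono_rev (@eq_mono A x _ p.1) // => i /=; rewrite opprK.
Qed.

Lemma ops_rev : ops_spec n q xr dr mur muinvr.
Proof.
case: opsx => dl [ml [vl [dm [mm vm]]]].
split; first by move=> i; exact: dl.
split; first by move=> i; exact: ml.
split; first by move=> i; exact: vl.
split.
  move=> i a Hi; rewrite !mono_rev [LHS]dm ?inIN // opprK.
  congr (_ *: (_ : A)).
  by apply: (@eq_mono A x) => j; rewrite /expo_dec eqr_oppLR.
split; move=> i a Hi; rewrite !mono_rev.
  by rewrite [LHS]mm ?inIN // opprK.
by rewrite [LHS]vm ?inIN // opprK.
Qed.

Lemma tauinvN_rev p : tauinvN n muinvr p = tauinvP n muinv p.
Proof.
by congr comp_seq; apply: eq_map => j; rewrite /muinvr opprK.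
Qed.

Lemma tauinvP_rev p : tauinvP n muinvr p = tauinvN n muinv p.
Proof. by []. Qed.

Lemma f_op1E u : f_op n q x d mu muinv 1 u = e_op n q xr dr mur muinvr 1 u.
Proof.
rewrite /f_op /e_op !eqxx tauinvN_rev tauinvP_rev !convM /xr /dr /muinvr.
by rewrite opprK.
Qed.

(** Reflection matches the summands of [f_op] and [e_op] in order; their signs are opposite here,
    whereas they agree for i = 1. *)
Lemma f_opE i u : i != 1%N ->
  f_op n q x d mu muinv i u = - e_op n q xr dr mur muinvr i u.
Proof.
move=> Hi; rewrite /f_op /e_op (negPf Hi) tauinvN_rev tauinvP_rev !convM.
rewrite /xr /dr /muinvr /mur !opprK !opprB.
by rewrite addrC.
Qed.

(** The two sides compose the same factors in different orders; these are diagonal on the normal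
    monomials, which span. *)
Lemma kinv_opE i u : (1 <= i <= n)%N -> kinv_op mu muinv i u = k_op mur muinvr i u.
Proof.
case: opsx => dl [ml [vl [dm [mm vm]]]] Hi; have [s ->] := spanx u.
rewrite /kinv_op /k_op /mur /muinvr; case: eqP => Ni /=.
  rewrite !opprK !(linearf_sum (ml _), linearf_sum (vl _)); apply: eq_bigr => p _.
  do !rewrite ?(linearfZ (ml _)) ?(linearfZ (vl _)) ?mm ?vm; try (rewrite /inI; lia).
  by rewrite !scalerA; congr (_ *: _); ring.
rewrite !opprB !opprK !(linearf_sum (ml _), linearf_sum (vl _)); apply: eq_bigr => p _.
do !rewrite ?(linearfZ (ml _)) ?(linearfZ (vl _)) ?mm ?vm; try (rewrite /inI; lia).
by rewrite !scalerA; congr (_ *: _); ring.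
Qed.

Lemma kinv_op_M i u v : (1 <= i <= n)%N ->
  kinv_op mu muinv i (u * v) = kinv_op mu muinv i u * kinv_op mu muinv i v.
Proof.
move=> Hi; rewrite !kinv_opE //.
exact: (@k_op_M _ _ _ _ _ _ _ _ q0 q_nroot rel_rev span_rev ops_rev i v u Hn Hi).
Qed.

Lemma kinv_op_1 i : (1 <= i <= n)%N -> kinv_op mu muinv i 1 = 1.
Proof.
move=> Hi; rewrite kinv_opE //.
by have := @k_op_1 _ _ _ _ _ _ _ _ q0 q_nroot rel_rev ops_rev i Hn Hi.
Qed.

Lemma f_op_M i u v : (1 <= i <= n)%N ->
  f_op n q x d mu muinv i (u * v) =
  f_op n q x d mu muinv i u * v + kinv_op mu muinv i u * f_op n q x d mu muinv i v.
Proof.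
move=> Hi; rewrite kinv_opE //.
(* In the opposite algebra this product is [v] times [u], hence the swapped arguments. *)
have E : e_op n q xr dr mur muinvr i (u * v) = _ :=
  @e_op_M _ _ _ _ _ _ _ _ q0 q_nroot rel_rev span_rev ops_rev i v u Hn Hi.
rewrite !convM in E.
have [Ei | Ni] := eqVneq i 1%N.
  by rewrite Ei in E *; rewrite !f_op1E E addrC.
by rewrite !f_opE // E opprD addrC mulNr mulrN.
Qed.

Lemma f_op_1 i : (1 <= i <= n)%N -> f_op n q x d mu muinv i 1 = 0.
Proof.
move=> Hi.
have E : e_op n q xr dr mur muinvr i 1 = 0 :=
  @e_op_1 _ _ _ _ _ _ _ _ q0 q_nroot rel_rev ops_rev i Hn Hi.
have [Ei | Ni] := eqVneq i 1%N; first by rewrite Ei in E *; rewrite f_op1E.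
by rewrite f_opE // [X in - X]E oppr0.
Qed.

Lemma f_op_lin i : linear (f_op n q x d mu muinv i).
Proof.
move=> c u v; have E := e_op_lin ops_rev i c u v.
have [Ei | Ni] := eqVneq i 1%N; first by rewrite Ei in E *; rewrite !f_op1E.
by rewrite !f_opE // [X in - X]E opprD scalerN.
Qed.

Lemma kinv_op_lin i : linear (kinv_op mu muinv i).
Proof.
case: opsx => dl [ml [vl _]] c u v; rewrite /kinv_op.
by case: eqP => _ /=; rewrite !(ml, vl).
Qed.

(** * The action of arbitrary terms, by induction on the term *)

Local Notation action := (act (n := n) q x d mu muinv).

(** Linearity lets the outer factor of a product of terms pass through the Sweedler sum of the inner
    one. *)
Lemma act_lin (h : Uterm k n) : linear (action h).
Proof.
elim: h => [j|j|j|j||a IHa b IHb|a IHa b IHb|e a IHa] c u v //=.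
- exact: (e_op_lin opsx).
- exact: f_op_lin.
- exact: (k_op_lin opsx).
- exact: kinv_op_lin.
- by rewrite IHa IHb addrACA scalerDr.
- by rewrite IHb IHa.
- by rewrite IHa scalerDr !scalerA mulrC.
Qed.

Lemma act_1 (h : Uterm k n) : action h 1 = counit h *: 1.
Proof.
have Hj (j : 'I_n) : (1 <= j.+1 <= n)%N by case: j => j /= ->.
elim: h => [j|j|j|j||a IHa b IHb|a IHa b IHb|e a IHa] /=.
- by rewrite (e_op_1 q0 q_nroot relx opsx Hn (Hj j)) scale0r.
- by rewrite (f_op_1 (Hj j)) scale0r.
- by rewrite (k_op_1 q0 q_nroot relx opsx Hn (Hj j)) scale1r.
- by rewrite (kinv_op_1 (Hj j)) scale1r.
- by rewrite scale1r.
- by rewrite IHa IHb scalerDl.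
- by rewrite IHb (linearfZ (act_lin a)) IHa scalerA mulrC.
- by rewrite IHa scalerA.
Qed.

Lemma act_M (h : Uterm k n) (u v : A) :
  action h (u * v) = \sum_(p <- coprod h) action p.1 u * action p.2 v.
Proof.
have Hj (j : 'I_n) : (1 <= j.+1 <= n)%N by case: j => j /= ->.
elim: h u v => [j|j|j|j||a IHa b IHb|a IHa b IHb|e a IHa] u v /=.
- rewrite !big_cons big_nil addr0 /=.
  exact: (e_op_M q0 q_nroot relx spanx opsx _ _ Hn (Hj j)).
- by rewrite !big_cons big_nil addr0 /= f_op_M.
- rewrite big_seq1 /=; exact: (k_op_M q0 q_nroot relx spanx opsx _ _ Hn (Hj j)).
- by rewrite big_seq1 /= kinv_op_M.
- by rewrite big_seq1.
- by rewrite IHa IHb big_cat.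
(* Expanding the inner factor first puts the sum over [coprod b] outside, while [coprod] has the sum
   over [coprod a] outside; hence the exchange. *)
- rewrite IHb (linearf_sum (act_lin a)) big_allpairs_dep exchange_big.
  by apply: eq_bigr => r _; rewrite IHa.
- rewrite IHa big_map scaler_sumr; apply: eq_bigr => p _ /=.
  by rewrite scalerAl.
Qed.

End ModuleAlgebra.

Unset Implicit Arguments.

Theorem theorem3p7 (k : fieldType) (A : algType k) (n : nat) (q : k)
    (x : int -> A) (d mu muinv : int -> A -> A) :
  [pchar k] =i pred0 ->
  q != 0 ->
  (forall m : nat, (0 < m)%N -> q ^+ m != 1) ->
  (2 <= n)%N ->
  qsymp_rel n q x ->
  normal_basis n x ->
  ops_spec n q x d mu muinv ->
  forall h : Uterm k n,
    act q x d mu muinv h 1 = counit h *: 1 /\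
    (forall u v : A,
       act q x d mu muinv h (u * v) =
       \sum_(p <- coprod h) act q x d mu muinv p.1 u * act q x d mu muinv p.2 v).
Proof.
move=> _ q0 q_nroot Hn relx [spanx _] opsx h.
by split=> [|u v]; [exact: act_1 | exact: act_M].
Qed.
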